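(* Let $\Omega\subset\mathbb{R}^n$ be a nonempty open bounded convex set satisfying an interior sphere condition, and let $u$ be the solution to the Dirichlet problem $-\Delta_\infty u=1$ in $\Omega$, $u=0$ on $\partial\Omega$. Then $u^{3/4}$ is concave in $\Omega$.
   Context: For smooth $\varphi$, $\Delta_\infty\varphi:=\langle\nabla^2\varphi\,\nabla\varphi,\nabla\varphi\rangle$. A solution to the Dirichlet problem is a function $u\in C(\overline\Omega)$ with $u=0$ on $\partial\Omega$ which is a viscosity solution of $-\Delta_\infty u=1$ in $\Omega$, i.e. for every $x_0\in\Omega$ and $\varphi\in C^2(\Omega)$: if $u-\varphi$ has a local maximum at $x_0$ then $-\Delta_\infty\varphi(x_0)-1\le 0$, and if $u-\varphi$ has a local minimum at $x_0$ then $-\Delta_\infty\varphi(x_0)-1\ge 0$. It is known that the solution exists, is unique, and is strictly positive in $\Omega$. Interior sphere condition: every point of $\partial\Omega$ lies on the boundary of some open ball contained in $\Omega$. *)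

(* Defs.v *)
From HB Require Import structures.
From mathcomp Require Import all_boot all_order all_algebra.
From mathcomp Require Import all_classical all_reals all_analysis.

Set Implicit Arguments.
Unset Strict Implicit.
Unset Printing Implicit Defensive.

Import Order.TTheory GRing.Theory Num.Theory.
Import numFieldNormedType.Exports.

Local Open Scope classical_set_scope.
Local Open Scope ring_scope.
Local Open Scope convex_scope.

Definition bd (T : topologicalType) (A : set T) : set T :=
  closure A `\` interior A.

Section Euclidean.
Context {R : realType} {n : nat}.
Implicit Types (x v w : 'rV[R]_n) (A Omega : set 'rV[R]_n).

Definition dotp v w : R := \sum_(i < n) v 0 i * w 0 i.

(* The library's norm and [ball] on 'rV[R]_n are those of the sup norm: same
   topology and bounded sets, but different balls. *)
Definition enorm v : R := Num.sqrt (dotp v v).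

Definition eball (c : 'rV[R]_n) (r : R) : set 'rV[R]_n :=
  [set x | enorm (x - c) < r].

Definition interior_sphere_condition Omega : Prop :=
  forall x, bd Omega x ->
    exists (c : 'rV[R]_n) (r : R),
      [/\ 0 < r, eball c r `<=` Omega & bd (eball c r) x].

Definition concave_function A (f : 'rV[R]_n -> R) : Prop :=
  forall t : {i01 R}, {in A &, forall x y : convex_lmodType 'rV[R]_n,
    (f x : R^o) <| t |> f y <= f (x <| t |> y)}.

End Euclidean.

Section InfinityLaplacian.
Context {R : realType} {n : nat}.
Implicit Types (f phi u : 'rV[R]_n -> R) (x : 'rV[R]_n) (Omega : set 'rV[R]_n).

Definition partial (i : 'I_n) f : 'rV[R]_n -> R :=
  fun x => 'D_(delta_mx 0 i) f x.

Definition grad f x : 'rV[R]_n := \row_i partial i f x.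

Definition hess f x : 'M[R]_n := \matrix_(i, j) partial j (partial i f) x.

(* Vectors are rows, so H v reads v *m H^T. *)
Definition infty_laplacian f x : R :=
  dotp (grad f x *m (hess f x)^T) (grad f x).

(* C^2(Omega) for an open Omega; the values of f off Omega are irrelevant. *)
Definition C2_on Omega f : Prop :=
  forall x, Omega x ->
    [/\ {for x, continuous f},
        forall i, derivable f x (delta_mx 0 i)
                  /\ {for x, continuous (partial i f)}
      & forall i j, derivable (partial i f) x (delta_mx 0 j)
                    /\ {for x, continuous (partial j (partial i f))}].

(* Omega is meant to be open, so that neighbourhoods of x0 in Omega and in the
   whole space define the same local extrema. *)
Definition local_max_at f x0 : Prop := \forall x \near x0, f x <= f x0.
Definition local_min_at f x0 : Prop := \forall x \near x0, f x0 <= f x.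

(* Viscosity solutions of - infty_laplacian u = 1 in Omega. *)
Definition viscosity_solution Omega u : Prop :=
  forall x0 phi, Omega x0 -> C2_on Omega phi ->
    (local_max_at (fun x => u x - phi x) x0 ->
       - infty_laplacian phi x0 - 1 <= 0) /\
    (local_min_at (fun x => u x - phi x) x0 ->
       0 <= - infty_laplacian phi x0 - 1).

Definition dirichlet_solution Omega u : Prop :=
  [/\ {within closure Omega, continuous u},
      forall x, bd Omega x -> u x = 0
    & viscosity_solution Omega u].

End InfinityLaplacian.

(* Main.v *)
Require Import Defs.
From HB Require Import structures.
From mathcomp Require Import all_boot all_order all_algebra.
From mathcomp Require Import all_classical all_reals all_analysis.
From mathcomp Require Import ring lra.

(* The operator enters only through sup-convolutions. If
     T_t u (x) = sup_y (u(y) - |x - y|^2 / (2t)),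
   then formally (d/dt)^2 T_t u = infty_laplacian u, and in fact u satisfies
   - infty_laplacian u <= kappa in the viscosity sense only if
   t |-> T_t u (x) + kappa t^2 / 2 is convex. A supersolution gives the same
   statement for - u with kappa = -1.

   Put w = u^(3/4) and suppose t1 w(x) + t2 w(y) - w(t1 x + t2 y + c) has a
   positive maximum. Regularise u at x and y by sup-convolutions and at
   z = t1 x + t2 y + c by an inf-convolution; at the maximum the gradients of w at
   x, y and z then exist and coincide. Follow the flows of T_t from x, y and z
   during times proportional to u^(1/2) (the scaling that leaves the equation
   invariant) and expand the maximality inequality to second order in time: since
   the equation for w has a right-hand side proportional to 1/w and the sum
   t1 w(x) + t2 w(y) exceeds w(z), the second-order terms contradict each other.

   Concavity is the case t1 = t, t2 = 1 - t, c = 0, provided the maximum is not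
   attained at a boundary point. That is the case t2 = 0, c = (1 - t) y with y on
   the boundary, where the inequality is trivial when u(x) = 0. *)

Set Implicit Arguments.
Unset Strict Implicit.
Unset Printing Implicit Defensive.

Import Order.TTheory GRing.Theory Num.Theory.
Import numFieldNormedType.Exports.

Local Open Scope classical_set_scope.
Local Open Scope ring_scope.

(** * Continuity of sums, differences and products on the whole space *)

Section GlobalContinuity.
Context {R : realType} {T : topologicalType} {V : normedModType R}.
Implicit Types (f g : T -> V) (h k : T -> R).

Lemma continuous_add f g :
  continuous f -> continuous g -> continuous (fun t => f t + g t).
Proof. by move=> cf cg t; apply: cvgD; [exact: cf|exact: cg]. Qed.

Lemma continuous_sub f g :
  continuous f -> continuous g -> continuous (fun t => f t - g t).
Proof. by move=> cf cg t; apply: cvgB; [exact: cf|exact: cg]. Qed.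

Lemma continuous_scale (a : R) f :
  continuous f -> continuous (fun t => a *: f t).
Proof. by move=> cf t; apply: cvgZr; exact: cf. Qed.

Lemma continuous_mul h k :
  continuous h -> continuous k -> continuous (fun t => h t * k t).
Proof. by move=> ch ck t; apply: cvgM; [exact: ch|exact: ck]. Qed.

End GlobalContinuity.

(** * The Euclidean inner product and the squared distance *)

Section DotProduct.
Context {R : realType} {n : nat}.
Implicit Types (x y v w : 'rV[R]_n) (a : R).

Lemma dotpC v w : dotp v w = dotp w v.
Proof. by apply: eq_bigr => i _; rewrite mulrC. Qed.

Lemma dotpDl x v w : dotp (x + v) w = dotp x w + dotp v w.
Proof. by rewrite -big_split; apply: eq_bigr => i _; rewrite mxE mulrDl. Qed.

Lemma dotpZl a v w : dotp (a *: v) w = a * dotp v w.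
Proof. by rewrite mulr_sumr; apply: eq_bigr => i _; rewrite mxE mulrA. Qed.

Lemma dotpNl v w : dotp (- v) w = - dotp v w.
Proof. by rewrite -scaleN1r dotpZl mulN1r. Qed.

Lemma dotpDr x v w : dotp x (v + w) = dotp x v + dotp x w.
Proof. by rewrite dotpC dotpDl !(dotpC x). Qed.

Lemma dotpZr a v w : dotp v (a *: w) = a * dotp v w.
Proof. by rewrite dotpC dotpZl dotpC. Qed.

Lemma dotpNr v w : dotp v (- w) = - dotp v w.
Proof. by rewrite dotpC dotpNl dotpC. Qed.

Definition dotpE := (dotpDl, dotpDr, dotpNl, dotpNr, dotpZl, dotpZr).

Lemma dotp_ge0 v : 0 <= dotp v v.
Proof. by apply: sumr_ge0 => i _; rewrite -expr2 sqr_ge0. Qed.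

Lemma dotp0 v : dotp v 0 = 0.
Proof. by rewrite -(scale0r 0) dotpZr mul0r. Qed.

Lemma dotp_eq0 v : (dotp v v == 0) = (v == 0).
Proof.
apply/eqP/eqP => [v0|->]; last by rewrite dotp0.
apply/rowP => i; rewrite mxE.
have /eqP := v0; rewrite psumr_eq0 => [/allP/(_ i)|j _]; last exact: sqr_ge0.
by rewrite mem_index_enum mulf_eq0 orbb => /(_ isT)/eqP.
Qed.

Lemma dotp_gt0 v : (0 < dotp v v) = (v != 0).
Proof. by rewrite lt_neqAle dotp_ge0 andbT eq_sym dotp_eq0. Qed.

Lemma dotp_sub_sqr (b q : 'rV[R]_n) :
  dotp (b - q) (b - q) = dotp b b - 2 * dotp b q + dotp q q.
Proof. by rewrite !dotpE (dotpC q b); ring. Qed.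

(** The difference of the two sides is [|s2 b + s1 q|^2 / (2 s1 s2 (s1 + s2))]. This is the
    inequality behind the semigroup property of sup-convolutions: a move split into two stages costs
    at least as much as the direct one. *)
Lemma dotp_split_le (b q : 'rV[R]_n) (s1 s2 : R) :
  0 < s1 -> 0 < s2 ->
  dotp (b - q) (b - q) / (2 * (s1 + s2)) <=
  dotp b b / (2 * s1) + dotp q q / (2 * s2).
Proof.
move=> s10 s20; rewrite dotp_sub_sqr -subr_ge0.
have := dotp_ge0 (s2 *: b - (- s1) *: q).
rewrite dotp_sub_sqr !(dotpZl, dotpZr).
set B := dotp b b; set M := dotp b q; set Q := dotp q q => H.
have -> : B / (2 * s1) + Q / (2 * s2) - (B - 2 * M + Q) / (2 * (s1 + s2)) =
   (s2 * (s2 * B) - 2 * (s2 * (- s1 * M)) + - s1 * (- s1 * Q))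
   / (2 * s1 * s2 * (s1 + s2)).
  by field; rewrite !gt_eqF//; lra.
by rewrite divr_ge0// !mulr_ge0 ?addr_ge0// ltW.
Qed.

Lemma dotp_convex x y (t : R) : 0 <= t <= 1 ->
  dotp (t *: x + (1 - t) *: y) (t *: x + (1 - t) *: y) <=
  t * dotp x x + (1 - t) * dotp y y.
Proof.
move=> /andP[t0 t1]; have := dotp_ge0 (x - y).
rewrite dotp_sub_sqr !dotpE (dotpC y x); set A := dotp x x; set B := dotp y y.
set M := dotp x y => H.
have : 0 <= t * (1 - t) by rewrite mulr_ge0// subr_ge0.
move=> /mulr_ge0/(_ H); lra.
Qed.

Lemma CauchySchwarz_dotp v w : dotp v w ^+ 2 <= dotp v v * dotp w w.
Proof.
have [->|w0] := eqVneq w 0; first by rewrite !dotp0 mulr0 expr0n.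
have := dotp_ge0 (v - (dotp v w / dotp w w) *: w).
rewrite -dotp_gt0 in w0; rewrite !dotpE (dotpC w v).
set a := dotp v v; set b := dotp v w; set c := dotp w w => H.
have -> : a * c = (a - b / c * b + (- (b / c * b) - (b / c * - (b / c * c)))) * c + b ^+ 2.
  by field; rewrite gt_eqF.
by rewrite lerDr; apply: mulr_ge0; [lra|exact: ltW].
Qed.

Lemma coord_sqr_le_dotp v i : v 0 i ^+ 2 <= dotp v v.
Proof.
rewrite /dotp (bigD1 i) //= expr2 lerDl.
by apply: sumr_ge0 => j _; rewrite -expr2 sqr_ge0.
Qed.

Lemma sqr_norm_le_dotp v : `|v| ^+ 2 <= dotp v v.
Proof.
have [v0|v0] := eqVneq `|v| 0; first by rewrite v0 expr0n dotp_ge0.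
have [i vi] := mx_norm_neq0 v0.
have -> : `|v| = `|v i.1 i.2| by [].
by rewrite real_normK ?num_real // (ord1 i.1) coord_sqr_le_dotp.
Qed.

Lemma continuous_dotp (T : topologicalType) (f g : T -> 'rV[R]_n) :
  continuous f -> continuous g -> continuous (fun t => dotp (f t) (g t)).
Proof.
move=> cf cg t; apply: cvg_big => [|i _]; first exact: add_continuous.
have cc (h : T -> 'rV[R]_n) : continuous h -> h x 0 i @[x --> t] --> h t 0 i.
  move=> ch; apply: (@continuous_comp _ _ _ h (fun v : 'rV[R]_n => v 0 i)).
    exact: ch.
  exact: (@coord_continuous R 1 n 0 i).
exact: cvgM (cc _ cf) (cc _ cg).
Qed.

Lemma continuous_dist2 (x0 : 'rV[R]_n) :
  continuous (fun y : 'rV[R]_n => dotp (y - x0) (y - x0)).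
Proof.
have cs : continuous (fun y : 'rV[R]_n => y - x0).
  by apply: continuous_sub => [y|]; [exact: cvg_id|exact: cst_continuous].
exact: continuous_dotp.
Qed.

(** Neighbourhoods are handled below through the squared Euclidean distance. One direction uses that
    the sup norm is at most the Euclidean norm, the other that the squared distance is
    continuous. *)
Lemma nbhs_dotpP x (P : set 'rV[R]_n) :
  nbhs x P <->
  exists2 e : R, 0 < e & forall y, dotp (y - x) (y - x) < e -> P y.
Proof.
split=> [/nbhs_ballP[e /= e0 eP]|[e e0 eP]].
  exists (e ^+ 2); first exact: exprn_gt0.
  move=> y ye; apply: eP; rewrite -ball_normE /ball_ /= distrC.
  rewrite -(@ltr_pXn2r _ 2) ?nnegrE ?normr_ge0 ?(ltW e0) //.
  exact: le_lt_trans (sqr_norm_le_dotp _) ye.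
have c := @continuous_dist2 x.
have : \forall y \near x, dotp (y - x) (y - x) < e.
  have /cvgr_lt := c x; apply.
  by rewrite subrr dotp0.
exact: filterS eP.
Qed.

End DotProduct.

(** * Extrema and uniform continuity on compact sets *)

Section CompactContinuity.
Context {R : realType}.

Lemma closed_superlevel (T : topologicalType) (f : T -> R) (a : R) :
  continuous f -> closed [set x | a <= f x].
Proof.
by move=> /continuous_closedP cf; apply: (cf [set y | a <= y]); exact: closed_ge.
Qed.

Lemma compact_max (T : topologicalType) (f : T -> R) (A : set T) :
  A !=set0 -> compact A -> continuous f ->
  exists2 x, A x & forall y, A y -> f y <= f x.
Proof.
move=> A0 cA cf.
have [x Ax M] := compact_EVT_max A0 cA (continuous_subspaceT cf).
by exists x => [|y Ay]; [exact/set_mem|exact/M/mem_set].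
Qed.

Lemma compact_min (T : topologicalType) (f : T -> R) (A : set T) :
  A !=set0 -> compact A -> continuous f ->
  exists2 x, A x & forall y, A y -> f x <= f y.
Proof.
move=> A0 cA cf.
have [x Ax M] := compact_EVT_min A0 cA (continuous_subspaceT cf).
by exists x => [|y Ay]; [exact/set_mem|exact/M/mem_set].
Qed.

(** The pairs in [D] whose values differ by at least [eps] form a compact set avoiding the diagonal;
    [delta] is the minimum of the squared distance on it. *)
Lemma compact_uniform_continuity n (D : set 'rV[R]_n) (w : 'rV[R]_n -> R) (eps : R) :
  compact D -> continuous w -> 0 < eps ->
  exists2 delta, 0 < delta & forall x y, D x -> D y ->
    dotp (x - y) (x - y) < delta -> `|w x - w y| < eps.
Proof.
move=> cD cw eps0.
pose V := ('rV[R]_n * 'rV[R]_n)%type.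
have c1 : continuous (fun p : V => p.1) by move=> p; exact: cvg_fst.
have c2 : continuous (fun p : V => p.2) by move=> p; exact: cvg_snd.
have cdiff : continuous (fun p : V => w p.1 - w p.2).
  apply: continuous_sub => p.
    by apply: (@continuous_comp _ _ _ (fun p : V => p.1) w); [exact: c1|exact: cw].
  by apply: (@continuous_comp _ _ _ (fun p : V => p.2) w); [exact: c2|exact: cw].
have cabs : continuous (fun p : V => `|w p.1 - w p.2|).
  move=> p; apply: (@continuous_comp _ _ _ (fun p : V => w p.1 - w p.2)
    (fun r : R => `|r|)); [exact: cdiff|exact: norm_continuous].
pose K := (D `*` D) `&` [set p : V | eps <= `|w p.1 - w p.2|].
have cK : compact K by apply: compact_closedI; [exact: compact_setX|exact: closed_superlevel].
have cdist : continuous (fun p : V => dotp (p.1 - p.2) (p.1 - p.2)).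
  have cs : continuous (fun p : V => p.1 - p.2) by exact: continuous_sub.
  exact: continuous_dotp.
have [K0|/set0P/negP/negPn/eqP K0] := pselect (K !=set0).
  have [[x y] [[/= Dx Dy] /= exy] M] := compact_min K0 cK cdist.
  exists (dotp (x - y) (x - y)).
    rewrite dotp_gt0 subr_eq0; apply/eqP => xy; move: exy.
    by rewrite xy subrr normr0 leNgt eps0.
  move=> x' y' Dx' Dy' lt; rewrite ltNge; apply/negP => ge.
  by have := M (x', y') (conj (conj Dx' Dy') ge); rewrite leNgt lt.
exists 1 => // x y Dx Dy _; rewrite ltNge; apply/negP => ge.
have : K (x, y) by [].
by rewrite K0.
Qed.

End CompactContinuity.

(** * Quadratic test functions for the infinity Laplacian *)

Section QuadraticTests.
Context {R : realType} {n : nat}.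
Implicit Types (x y v G : 'rV[R]_n) (Omega : set 'rV[R]_n) (f u : 'rV[R]_n -> R).

Lemma is_derive_quadratic f x v (a b : R) :
  (forall h : R, f (h *: v + x) = f x + a * h + b * h ^+ 2) ->
  is_derive x v f a.
Proof.
move=> fE.
have cvga : (fun h : R => h^-1 *: ((f \o shift x) (h *: v) - f x)) @ 0^' --> a.
  have : (fun h : R => a + b * h) @ 0^' --> a.
    have : (fun h : R => a + b * h) @ 0^' --> a + b * 0.
      apply: cvgD; first exact: cvg_cst.
      apply: cvgM; first exact: cvg_cst.
      exact: nbhs_dnbhs.
    by rewrite mulr0 addr0.
  apply: cvg_trans; apply: near_eq_cvg; near=> h.
  have h0 : h != 0 by near: h; exact: nbhs_dnbhs_neq.
  by rewrite /= fE -[RHS]/(_ * _); field.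
by apply: DeriveDef; [apply/cvg_ex; exists a|exact: cvg_lim cvga].
Unshelve. all: by end_near. Qed.

(** The polynomial vanishing at [x0] with gradient [G] there and Hessian [k G^T G + L Id]. The
    rank-one term adjusts the second derivative along the gradient, the only one the operator sees,
    and [L] controls the other directions. *)
Definition quadratic_test (G : 'rV[R]_n) (k L : R) (x0 x : 'rV[R]_n) : R :=
  dotp G (x - x0) + k / 2 * dotp G (x - x0) ^+ 2
  + L / 2 * dotp (x - x0) (x - x0).

Lemma dotp_delta v i : dotp v (delta_mx 0 i) = v 0 i.
Proof.
rewrite /dotp (bigD1 i) //= mxE !eqxx mulr1 big1 ?addr0 // => j ji.
by rewrite mxE (negbTE ji) andbF mulr0.
Qed.

Lemma is_derive_quadratic_test G k L x0 x v :
  is_derive x v (quadratic_test G k L x0)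
    (dotp G v + k * dotp G (x - x0) * dotp G v + L * dotp (x - x0) v).
Proof.
apply: (@is_derive_quadratic _ _ _ _
  (k / 2 * dotp G v ^+ 2 + L / 2 * dotp v v)) => h.
rewrite /quadratic_test !dotpE (dotpC v x) (dotpC v x0) (dotpC x0 x).
by field.
Qed.

Lemma partial_quadratic_test G k L x0 i :
  partial i (quadratic_test G k L x0) =
  fun x => G 0 i + k * G 0 i * dotp G (x - x0) + L * (x - x0) 0 i.
Proof.
apply/funext => x.
have := is_derive_quadratic_test G k L x0 x (delta_mx 0 i).
rewrite !dotp_delta /partial => dx; rewrite derive_val; ring.
Qed.

Lemma is_derive_partial_quadratic_test G k L x0 i j x :
  is_derive x (delta_mx 0 j) (partial i (quadratic_test G k L x0))
    (k * G 0 i * G 0 j + L * (i == j)%:R).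
Proof.
rewrite partial_quadratic_test.
apply: (@is_derive_quadratic _ _ _ _ 0) => h.
rewrite !dotpE dotp_delta !mxE eqxx /=; ring.
Qed.

Lemma hess_quadratic_test G k L x0 x :
  hess (quadratic_test G k L x0) x = k *: (G^T *m G) + L%:M.
Proof.
apply/matrixP => i j; rewrite !mxE.
have dx := is_derive_partial_quadratic_test G k L x0 i j x.
by rewrite /partial derive_val big_ord1 !mxE mulrA mulr_natr.
Qed.

Lemma continuous_affine G x0 (a b : R) :
  continuous (fun x : 'rV[R]_n => a + b * dotp G (x - x0)).
Proof.
apply: continuous_add; first exact: cst_continuous.
apply: continuous_mul; first exact: cst_continuous.
apply: continuous_dotp; first exact: cst_continuous.
by apply: continuous_sub => [y|]; [exact: cvg_id|exact: cst_continuous].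
Qed.

Lemma continuous_quadratic_test G k L x0 :
  continuous (quadratic_test G k L x0).
Proof.
have cs : continuous (fun y : 'rV[R]_n => y - x0).
  by apply: continuous_sub => [y|]; [exact: cvg_id|exact: cst_continuous].
have cG : continuous (fun y : 'rV[R]_n => dotp G (y - x0)).
  by apply: continuous_dotp => //; exact: cst_continuous.
apply: continuous_add; first apply: continuous_add => //.
  by apply: continuous_mul; [exact: cst_continuous|exact: continuous_mul].
apply: continuous_mul; first exact: cst_continuous.
exact: continuous_dotp.
Qed.

Lemma C2_quadratic_test G k L x0 Omega : C2_on Omega (quadratic_test G k L x0).
Proof.
move=> x _; split; first exact: continuous_quadratic_test.
- move=> i; split.
    by have [] := is_derive_quadratic_test G k L x0 x (delta_mx 0 i).
  have -> : partial i (quadratic_test G k L x0) = fun x =>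
      (G 0 i + k * G 0 i * dotp G (x - x0))
      + (0 + L * dotp (delta_mx 0 i) (x - x0)).
    rewrite partial_quadratic_test; apply/funext => y.
    by rewrite add0r (dotpC (delta_mx _ _)) dotp_delta.
  by apply: continuous_add; exact: continuous_affine.
- move=> i j; split.
    by have [] := is_derive_partial_quadratic_test G k L x0 i j x.
  have -> : partial j (partial i (quadratic_test G k L x0)) =
      cst (k * G 0 i * G 0 j + L * (i == j)%:R).
    apply/funext => y.
    have dy := is_derive_partial_quadratic_test G k L x0 i j y.
    by rewrite [LHS]/partial derive_val.
  exact: cst_continuous.
Qed.

Lemma infty_laplacian_quadratic_test G k L x0 :
  infty_laplacian (quadratic_test G k L x0) x0 =
  k * dotp G G ^+ 2 + L * dotp G G.
Proof.
have -> : infty_laplacian (quadratic_test G k L x0) x0 =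
    dotp (G *m (k *: (G^T *m G) + L%:M)^T) G.
  rewrite /infty_laplacian hess_quadratic_test; congr (dotp (_ *m _) _);
  by apply/rowP => i; rewrite mxE partial_quadratic_test subrr dotp0 mxE !mulr0 !addr0.
rewrite linearD linearZ /= trmx_mul trmxK tr_scalar_mx mulmxDr -scalemxAr.
rewrite mul_mx_scalar mulmxA dotpDl !dotpZl; congr (_ * _ + _).
have -> : G *m G^T = (dotp G G)%:M.
  apply/matrixP => i j; rewrite !mxE !ord1 eqxx mulr1n.
  by apply: eq_bigr => l _; rewrite mxE.
by rewrite mul_scalar_mx dotpZl expr2.
Qed.

(* Viscosity inequality [- infty_laplacian f <= kappa], tested from above by
   quadratic functions only. *)
Definition quadratic_subsolution (Omega : set 'rV[R]_n) (kappa : R) f : Prop :=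
  forall x G k L, Omega x ->
    (\forall y \near x, f y <= f x + quadratic_test G k L x y) ->
    - (k * dotp G G ^+ 2 + L * dotp G G) <= kappa.

Lemma quadratic_test0 G k L x : quadratic_test G k L x x = 0.
Proof. by rewrite /quadratic_test subrr !dotp0 expr0n !mulr0 !addr0. Qed.

(** The operator is cubic, hence odd. A test of [- u] from above with coefficients [G], [k], [L] is
    a test of [u] from below with [- G], [- k], [- L], which turns the supersolution inequality into
    the subsolution inequality with constant [-1]. *)
Lemma viscosity_quadratic_subsolution Omega u :
  viscosity_solution Omega u ->
  quadratic_subsolution Omega 1 u /\
  quadratic_subsolution Omega (-1) (fun x => - u x).
Proof.
move=> visc; split=> x G k L Ox tx.
- have [+ _] := visc x _ Ox (@C2_quadratic_test G k L x Omega).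
  rewrite infty_laplacian_quadratic_test subr_le0; apply.
  by apply: filterS tx => y; rewrite quadratic_test0; lra.
- have [_] := visc x _ Ox (@C2_quadratic_test (- G) (- k) (- L) x Omega).
  rewrite infty_laplacian_quadratic_test !(dotpNl, dotpNr) opprK => H.
  suff : 0 <= - (- k * dotp G G ^+ 2 + - L * dotp G G) - 1 by lra.
  apply: H; apply: filterS tx => y.
  rewrite quadratic_test0 /quadratic_test !(dotpNl, dotpNr).
  by rewrite sqrrN; lra.
Qed.

End QuadraticTests.

(** First-order condition at an extremum, free of derivatives: for small [t > 0], the choice
    [d = - t A] gives the value [- t A^2 (1 - t K)], which is negative unless [A = 0]. *)
Lemma linear_coef_eq0 {R : realFieldType} (A K r : R) : 0 < r ->
  (forall d, `|d| < r -> 0 <= A * d + K * d ^+ 2) -> A = 0.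
Proof.
move=> r0 H; apply/eqP/negPn/negP => A0.
have nA : 0 < `|A| by rewrite normr_gt0.
have nK : 0 <= `|K| by [].
pose t := Num.min (r / (2 * `|A|)) (1 / (2 * (`|K| + 1))).
have t0 : 0 < t by rewrite lt_min !divr_gt0//; lra.
have tA : t * `|A| < r.
  have : t <= r / (2 * `|A|) by rewrite ge_min lexx.
  rewrite ler_pdivlMr ?mulr_gt0// => tr.
  apply: (@le_lt_trans _ _ (r / 2)); lra.
have tK : t * `|K| < 1.
  have : t <= 1 / (2 * (`|K| + 1)) by rewrite ge_min lexx orbT.
  rewrite ler_pdivlMr; last by lra.
  move=> tr; apply: (@le_lt_trans _ _ (1 / 2)); nra.
have := H (- (t * A)); rewrite normrN normrM (gtr0_norm t0) => /(_ tA).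
apply/negP; rewrite -ltNge.
have -> : A * - (t * A) + K * (- (t * A)) ^+ 2 = - (t * A ^+ 2 * (1 - t * K)) by ring.
rewrite oppr_lt0; apply: mulr_gt0; first by rewrite mulr_gt0 // exprn_even_gt0.
have := ler_norm K; nra.
Qed.

(** * Convexity in time of sup-convolutions *)

Section HopfLax.
Context {R : realType} {n : nat}.
Variables (Omega D : set 'rV[R]_n) (f : 'rV[R]_n -> R) (kappa : R).
Hypothesis Omega_open : open Omega.
Hypothesis OmegaD : Omega `<=` D.
Hypothesis D_compact : compact D.
Hypothesis f_cont : continuous f.
Hypothesis f_sub : quadratic_subsolution Omega kappa f.

(** Its supremum over [y] is the sup-convolution of [g] at [x0], that is, the Hopf-Lax formula at
    time [s] for [v_t = |Dv|^2 / 2]. *)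
Definition penalized (g : 'rV[R]_n -> R) (x0 : 'rV[R]_n) (s : R) y : R :=
  g y - dotp (y - x0) (y - x0) / (2 * s).

(** At a local maximum in time the derivative of [chi] equals that of [- |y1 - x0|^2 / (2 t)]. *)
Lemma penalized_time_critical x0 y1 (s1 r A B kappa' s : R) :
  let chi t := A + B * (t - s) - kappa' / 2 * (t - s) ^+ 2 in
  0 < s1 -> 0 < r ->
  (forall t, `|t - s1| < r ->
    penalized f x0 t y1 - chi t <= penalized f x0 s1 y1 - chi s1) ->
  B - kappa' * (s1 - s) = dotp (y1 - x0) (y1 - x0) / (2 * s1 ^+ 2).
Proof.
move=> chi s10 r0; rewrite /penalized; set S := dotp _ _ => H.
apply/eqP; rewrite -subr_eq0; apply/eqP.
have S0 : 0 <= S by exact: dotp_ge0.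
(* The radius [s1 / 2] keeps [s1 + d] above [s1 / 2], so the second-order remainder of
   [S / (2 * (s1 + d))] is at most [S / s1 ^+ 3 * d ^+ 2]. *)
apply: (@linear_coef_eq0 _ _ (S / s1 ^+ 3 - kappa' / 2) (Num.min r (s1 / 2))).
  by rewrite lt_min r0 divr_gt0.
move=> d; rewrite lt_min => /andP[dr ds1].
have := H (s1 + d); rewrite [s1 + d]addrC addrK => /(_ dr).
have sd : s1 / 2 < s1 + d by have := ler_norm (- d); rewrite normrN; lra.
have -> : S / (2 * (d + s1)) = S / (2 * s1) - S * d / (2 * s1 ^+ 2)
    + S * d ^+ 2 / (2 * s1 ^+ 2 * (s1 + d)).
  by field; rewrite !gt_eqF//; lra.
have : S * d ^+ 2 / (2 * s1 ^+ 2 * (s1 + d)) <= S / s1 ^+ 3 * d ^+ 2.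
  rewrite [leRHS]mulrAC ler_wpM2l//; first by rewrite mulr_ge0// sqr_ge0.
  rewrite lef_pV2 ?posrE ?mulr_gt0 ?exprn_gt0//; last by lra.
  rewrite exprSr -mulrA mulrCA ler_wpM2l ?sqr_ge0//; lra.
rewrite /chi; set X := S * d ^+ 2 / _; set Y := S / (2 * s1).
have -> : S * d / (2 * s1 ^+ 2) = S / (2 * s1 ^+ 2) * d by ring.
lra.
Qed.

(** If [y1] differs from [x0], letting the time depend on [y] turns maximality into a quadratic test
    of [f] from above at [y1]. Its operator value is [- kappa'], whence [kappa' <= kappa], a
    contradiction. At [y1 = x0] the gradient of the test would vanish. *)
Lemma penalized_interior_max x0 y1 (s1 r A B kappa' s : R) :
  let chi t := A + B * (t - s) - kappa' / 2 * (t - s) ^+ 2 in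
  0 < s1 -> 0 < r -> Omega y1 -> kappa < kappa' ->
  (forall t y, `|t - s1| < r -> D y ->
    penalized f x0 t y - chi t <= penalized f x0 s1 y1 - chi s1) ->
  y1 = x0.
Proof.
move=> chi s10 r0 Oy1 kk' H.
apply/eqP/negPn/negP => y1x0.
have crit := @penalized_time_critical x0 y1 s1 r A B kappa' s s10 r0
  (fun t tr => H t y1 tr (OmegaD Oy1)).
have [v vE] : {v | v = y1 - x0} by exists (y1 - x0).
have v0 : v != 0 by rewrite vE subr_eq0.
rewrite -vE in crit.
rewrite -dotp_gt0 in v0.
set S := dotp v v in crit v0.
(* The term [- 2 * s1 / S] cancels the effect of [L = 2 / s1] along [v], leaving exactly [- kappa'].
   Across [v], [2 / s1] is twice the curvature of the penalty at time [s1], which leaves room for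
   the time to drop to [s1 / 2]. *)
have := @f_sub y1 (s1^-1 *: v) (- kappa' * s1 ^+ 4 / S ^+ 2 - 2 * s1 / S)
  (2 / s1) Oy1.
rewrite !dotpE -/S.
have -> : - ((- kappa' * s1 ^+ 4 / S ^+ 2 - 2 * s1 / S)
    * (s1^-1 * (s1^-1 * S)) ^+ 2 + 2 / s1 * (s1^-1 * (s1^-1 * S))) = kappa'.
  by field; rewrite !gt_eqF.
suff near : \forall y \near y1, f y <= f y1 + quadratic_test (s1^-1 *: v)
    (- kappa' * s1 ^+ 4 / S ^+ 2 - 2 * s1 / S) (2 / s1) y1 y.
  by move/(_ near); lra.
(* Below, [E] is the component of [y - y1] along [v] relative to [v]. By Cauchy-Schwarz [|E| < m],
   so the time [s1 (1 + E)] stays within [r] of [s1] and above [s1 / 2]. *)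
pose m := Num.min (r / s1) (1 / 2).
have m0 : 0 < m by rewrite lt_min !divr_gt0.
have nearD : \forall y \near y1, D y.
  by apply: filterS OmegaD _; exact: open_nbhs_nbhs.
have nearE : \forall y \near y1, dotp (y - y1) (y - y1) < S * m ^+ 2.
  by apply/nbhs_dotpP; exists (S * m ^+ 2) => //; rewrite mulr_gt0 ?exprn_gt0.
near=> y.
have Dy : D y by near: y.
have yE : dotp (y - y1) (y - y1) < S * m ^+ 2 by near: y.
have [d dE] : {d | d = y - y1} by exists (y - y1).
rewrite -dE in yE; set X := dotp d d in yE.
pose E := dotp v d / S.
have vd : dotp v d = S * E by rewrite /E; field; rewrite gt_eqF.
have XE : S * E ^+ 2 <= X.
  have := CauchySchwarz_dotp v d; rewrite vd -/S -/X => CS.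
  by rewrite -(@ler_pM2l _ S) //; lra.
have Em : `|E| < m.
  rewrite -(@ltr_pXn2r _ 2) ?nnegrE ?normr_ge0 ?(ltW m0)//.
  by rewrite real_normK ?num_real// -(@ltr_pM2l _ S)//; lra.
move: (Em); rewrite lt_min ltr_pdivlMr// => /andP[Er Eh].
have E1 : 1 / 2 < 1 + E by have := ler_norm (- E); rewrite normrN; lra.
(* The test function is [penalized] at the time [s1 (1 + E)], chosen so that
   [S (1 + E)^2 / (2 s1 (1 + E))], the part of [|y - x0|^2 / (2 t)] along [v], is
   affine in [y]: the second derivative along [v] then comes from [chi] only. *)
have := H (s1 * (1 + E)) y; rewrite mulrDr mulr1 addrAC subrr add0r.
rewrite normrM (gtr0_norm s10) mulrC => /(_ Er Dy).
rewrite /penalized -vE -/S.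
have -> : y - x0 = v + d by rewrite vE dE [RHS]addrC subrKA.
rewrite /quadratic_test -dE !dotpE -/S -/X (dotpC d v) vd (mulrC s1 E).
have sE : 0 < s1 + E * s1 by nra.
have -> : (S + S * E + (S * E + X)) / (2 * (s1 + E * s1)) =
    S * (1 + E) / (2 * s1) + (X - S * E ^+ 2) / (2 * s1 * (1 + E)).
  by field; rewrite !gt_eqF//; lra.
have : (X - S * E ^+ 2) / (2 * s1 * (1 + E)) <= (X - S * E ^+ 2) / s1.
  rewrite ler_wpM2l//; first by lra.
  by rewrite lef_pV2 ?posrE ?mulr_gt0//; nra.
have -> : chi (s1 + E * s1) =
    chi s1 + (B - kappa' * (s1 - s)) * (E * s1) - kappa' / 2 * (E * s1) ^+ 2.
  by rewrite /chi; field.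
rewrite crit.
have -> : S / (2 * s1 ^+ 2) * (E * s1) = S * E / (2 * s1) by field; rewrite gt_eqF.
set Z := (X - _) / (2 * _ * _).
have -> : s1^-1 * (S * E) + (- kappa' * s1 ^+ 4 / S ^+ 2 - 2 * s1 / S) / 2
    * (s1^-1 * (S * E)) ^+ 2 + 2 / s1 / 2 * X =
   S * E / s1 - kappa' / 2 * (E * s1) ^+ 2 + (X - S * E ^+ 2) / s1.
  by field; rewrite !gt_eqF.
set W := (X - _) / s1.
have -> : S * (1 + E) / (2 * s1) = S / (2 * s1) + S * E / (2 * s1) by ring.
have -> : S * E / s1 = S * E / (2 * s1) + S * E / (2 * s1) by field; rewrite gt_eqF.
set c1 := S * E / (2 * s1); set c2 := S / (2 * s1); set c3 := chi s1.
set c4 := kappa' / 2 * _.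
lra.
Unshelve. all: by end_near. Qed.

Lemma penalized_max x0 s : D !=set0 ->
  exists2 y, D y & forall z, D z -> penalized f x0 s z <= penalized f x0 s y.
Proof.
move=> D0; apply: compact_max => //.
apply: continuous_sub; first exact: f_cont.
by apply: continuous_mul; [exact: continuous_dist2|exact: cst_continuous].
Qed.

Lemma penalized_joint_max x0 s tau (chi : R -> R) : D !=set0 ->
  0 < s -> 0 < s + tau -> continuous chi ->
  let P t y := penalized f x0 (s + t * tau) y - chi t in
  exists t1 y1, [/\ 0 <= t1 <= 1, D y1 &
    forall t y, 0 <= t <= 1 -> D y -> P t y <= P t1 y1].
Proof.
move=> [y0 Dy0] s0 st0 cchi P.
pose A : set (R * 'rV[R]_n) := `[0, 1]%classic `*` D.
have A0 : A !=set0 by exists (0, y0); split => //=; rewrite in_itv /= lexx ler01.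
have cA : compact A by apply: compact_setX => //; exact: segment_compact.
have cf : {within A, continuous (fun z => P z.1 z.2)}.
  apply: continuous_in_subspaceT => -[t y] /set_mem[/= + Dy].
  rewrite in_itv /= => /andP[t0 t1].
  have tt : 0 < s + t * tau.
    have -> : s + t * tau = (1 - t) * s + t * (s + tau) by ring.
    have [->|tn0] := eqVneq t 0; first by rewrite subr0 mul1r mul0r addr0.
    rewrite ltr_wpDl ?mulr_ge0 ?subr_ge0 ?(ltW s0)//.
    by rewrite mulr_gt0 // lt_neqAle eq_sym tn0.
  have c1 : continuous (fun z : R * 'rV[R]_n => z.1) by move=> z; exact: cvg_fst.
  have c2 : continuous (fun z : R * 'rV[R]_n => z.2) by move=> z; exact: cvg_snd.
  apply: cvgB.
    apply: cvgB.
      apply: (@continuous_comp _ _ _ (fun z : R * 'rV[R]_n => z.2) f); [exact: c2|exact: f_cont].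
    apply: cvgM.
      by apply: (@continuous_comp _ _ _ (fun z : R * 'rV[R]_n => z.2)
        (fun y : 'rV[R]_n => dotp (y - x0) (y - x0))); [exact: c2|exact: continuous_dist2].
    apply: cvgV; first by rewrite /= mulf_neq0 // gt_eqF.
    apply: cvgM; first exact: cvg_cst.
    apply: cvgD; first exact: cvg_cst.
    by apply: cvgM; [exact: c1|exact: cvg_cst].
  by apply: (@continuous_comp _ _ _ (fun z : R * 'rV[R]_n => z.1) chi); [exact: c1|exact: cchi].
have [[t1 y1] /set_mem[/= tI Dy1] M] := compact_EVT_max A0 cA cf.
exists t1, y1; split => //.
move=> t y tI' Dy; apply: (M (t, y)); by apply/mem_set; split.
Qed.

(* Convexity of [t |-> T_t f x0 + kappa t^2 / 2] in tangent form, where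
   [T_t f x0] is the maximum of [penalized f x0 t] over [D], whose derivative at
   [s] is [|x1 - x0|^2 / (2 s^2)]. *)
Lemma hopf_lax_step x0 x1 s tau : D x0 -> D x1 ->
  0 < s -> 0 < s + tau -> tau != 0 -> kappa < 0 \/ 0 < tau /\ 0 <= kappa ->
  (forall y, D y -> penalized f x0 s y <= penalized f x0 s x1) ->
  (forall t y1, 0 < t < 1 -> D y1 ->
    (forall y, D y ->
      penalized f x0 (s + t * tau) y <= penalized f x0 (s + t * tau) y1) ->
    Omega y1) ->
  exists2 x2, D x2 & penalized f x0 s x1
    + tau * (dotp (x1 - x0) (x1 - x0) / s ^+ 2) / 2 - kappa * tau ^+ 2 / 2
    <= penalized f x0 (s + tau) x2.
Proof.
move=> Dx0 Dx1 s0 st0 tau0 kap x1M int.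
have D0 : D !=set0 by exists x0.
have [x2 Dx2 x2M] := penalized_max x0 (s + tau) D0.
exists x2 => //; rewrite leNgt; apply/negP => gap.
set F := penalized f x0 s x1 in gap x1M.
set S1 := dotp _ _ in gap.
have S10 : 0 <= S1 by exact: dotp_ge0.
set p2 := S1 / s ^+ 2 in gap.
set F2 := penalized f x0 (s + tau) x2 in gap x2M.
have [g gE] : {g | g = F + tau * p2 / 2 - kappa * tau ^+ 2 / 2 - F2}.
  by eexists; reflexivity.
have g0 : 0 < g by rewrite gE subr_gt0.
have tau2 : 0 < tau ^+ 2 by rewrite exprn_even_gt0.
(* Here [g] is the amount by which the claim fails. The parabola [psi] starts at [F] with slope
   smaller by [g / 4] than that of the sup-convolution, and ends at [F2 + g / 4]. The
   sup-convolution minus [psi] is thus nonpositive at both ends but positive just after [0], so its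
   maximum is interior. *)
pose kappa' := kappa + g / tau ^+ 2.
have kk' : kappa < kappa' by rewrite ltrDl divr_gt0.
pose B := p2 / 2 - g / 4 / tau.
pose chi t := F + B * (t - s) - kappa' / 2 * (t - s) ^+ 2.
pose psi t := chi (s + t * tau).
have psiE t : psi t = F + t * (tau * p2 / 2 - g / 4)
    - t ^+ 2 * (kappa * tau ^+ 2 / 2 + g / 2).
  rewrite /psi /chi [s + _]addrC addrK /B /kappa'; field.
  exact: tau0.
have cpsi : continuous psi.
  have -> : psi = fun t => F + t * (tau * p2 / 2 - g / 4)
    - (t * t) * (kappa * tau ^+ 2 / 2 + g / 2).
    by apply/funext => t; rewrite psiE expr2.
  have ci : continuous (fun t : R => t) by move=> t; exact: cvg_id.
  apply: continuous_sub; last first.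
    by apply: continuous_mul; [exact: continuous_mul|exact: cst_continuous].
  apply: continuous_add; first exact: cst_continuous.
  by apply: continuous_mul => //; exact: cst_continuous.
have [t1 [y1 [/andP[t10 t11] Dy1 M]]] := penalized_joint_max x0 D0 s0 st0 cpsi.
have pos : 0 < penalized f x0 (s + t1 * tau) y1 - psi t1.
  (* [K] bounds the second-order terms for the competitor [x1], and [t] is so small that
     [t ^+ 2 * K <= t * (g / 8)], half of the first-order gain [t * (g / 4)]. *)
  pose K := tau ^+ 2 * S1 / s ^+ 3 + `|kappa| * tau ^+ 2 + g.
  have K0 : 0 < K.
    have := ltW s0; have := ltW tau2 => tau2' s0'.
    rewrite ltr_wpDl// addr_ge0//; last exact: mulr_ge0.
    by rewrite divr_ge0 ?exprn_ge0// mulr_ge0.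
  pose t := Num.min (1 / 2) (Num.min (g / (8 * K)) (s / (2 * `|tau|))).
  have nt0 : 0 < `|tau| by rewrite normr_gt0.
  have t0 : 0 < t by rewrite !lt_min !divr_gt0 ?mulr_gt0.
  have th : t <= 1 / 2 by rewrite !ge_min lexx.
  have tK : t * (8 * K) <= g.
    by rewrite -ler_pdivlMr ?mulr_gt0// !ge_min lexx !orbT.
  have ts : t * (2 * `|tau|) <= s.
    by rewrite -ler_pdivlMr ?mulr_gt0// !ge_min lexx !orbT.
  have std : s / 2 <= s + t * tau.
    have : - (t * tau) <= t * `|tau|.
      by rewrite -mulrN ler_wpM2l ?(ltW t0)// -normrN ler_norm.
    lra.
  apply: lt_le_trans (M t x1 _ Dx1); last by apply/andP; split; lra.
  rewrite psiE /penalized -/S1.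
  have -> : F = f x1 - S1 / (2 * s) by [].
  have -> : S1 / (2 * (s + t * tau)) = S1 / (2 * s) - t * (tau * p2 / 2)
      + t ^+ 2 * tau ^+ 2 * S1 / (2 * s ^+ 2 * (s + t * tau)).
    by rewrite /p2; field; rewrite !gt_eqF//; lra.
  have : t ^+ 2 * tau ^+ 2 * S1 / (2 * s ^+ 2 * (s + t * tau)) <=
      t ^+ 2 * tau ^+ 2 * S1 / s ^+ 3.
    apply: ler_wpM2l; first by rewrite mulr_ge0// mulr_ge0 ?sqr_ge0.
    rewrite lef_pV2 ?posrE ?mulr_gt0 ?exprn_gt0//; last by lra.
    rewrite exprSr -mulrA mulrCA ler_wpM2l ?sqr_ge0//; lra.
  set c1 := _ / (2 * s ^+ 2 * _); set c2 := S1 / (2 * s).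
  have : t ^+ 2 * K <= t * (g / 8).
    by rewrite expr2 -mulrA ler_wpM2l ?(ltW t0)//; lra.
  have : - (`|kappa| * (t ^+ 2 * tau ^+ 2)) <= kappa * (t ^+ 2 * tau ^+ 2).
    rewrite -mulNr; apply: ler_wpM2r; first by rewrite mulr_ge0 ?sqr_ge0.
    by rewrite lerNl -normrN ler_norm.
  have : 0 <= `|kappa| * (t ^+ 2 * tau ^+ 2).
    by rewrite mulr_ge0// mulr_ge0 ?sqr_ge0.
  have : 0 < t ^+ 2 * g by rewrite mulr_gt0 ?exprn_gt0.
  have : 0 < t * g by rewrite mulr_gt0.
  have -> : t ^+ 2 * K = t ^+ 2 * tau ^+ 2 * S1 / s ^+ 3 +
    `|kappa| * (t ^+ 2 * tau ^+ 2) + t ^+ 2 * g by rewrite /K; ring.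
  set c3 := _ / s ^+ 3; set c4 := `|kappa| * _; set c5 := kappa * _.
  have -> : t ^+ 2 * (kappa * tau ^+ 2 / 2 + g / 2) = c5 / 2 + t ^+ 2 * g / 2.
    by rewrite /c5; field.
  lra.
have t1n0 : t1 != 0.
  apply/eqP => t1E; move: pos; rewrite t1E mul0r addr0 psiE expr0n !mul0r.
  by have := x1M _ Dy1; lra.
have t1n1 : t1 != 1.
  apply/eqP => t1E; move: pos; rewrite t1E mul1r psiE expr1n.
  by have := x2M _ Dy1; rewrite -/F2 gE in g0 *; lra.
have {}t10 : 0 < t1 by rewrite lt_neqAle eq_sym t1n0.
have {}t11 : t1 < 1 by rewrite lt_neqAle t1n1.
pose s1 := s + t1 * tau.
have s10 : 0 < s1.
  have -> : s1 = (1 - t1) * s + t1 * (s + tau) by rewrite /s1; ring.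
  by rewrite addr_gt0 ?mulr_gt0 ?subr_gt0.
have Oy1 : Omega y1.
  apply: (int t1) => //; first by rewrite t10.
  move=> y Dy; have := M t1 y _ Dy; rewrite (ltW t10) (ltW t11) => /(_ isT); lra.
pose r := `|tau| * Num.min t1 (1 - t1).
have r0 : 0 < r by rewrite mulr_gt0 ?normr_gt0 // lt_min t10 subr_gt0.
have Mloc t y : `|t - s1| < r -> D y ->
    penalized f x0 t y - chi t <= penalized f x0 s1 y1 - chi s1.
  move=> tr Dy.
  have tE : t = s + (t - s) / tau * tau by rewrite mulfVK // addrC subrK.
  have := M ((t - s) / tau) y _ Dy; rewrite /psi -tE -/s1; apply.
  have : `|(t - s) / tau - t1| < Num.min t1 (1 - t1).
    rewrite -(@ltr_pM2l _ `|tau|) ?normr_gt0// -normrM.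
    have -> : tau * ((t - s) / tau - t1) = t - s1.
      by rewrite /s1; field; exact: tau0.
    exact: tr.
  rewrite lt_min !ltr_norml => /andP[/andP[? ?] /andP[? ?]].
  by apply/andP; split; lra.
have y1x0 : y1 = x0.
  exact: (@penalized_interior_max x0 y1 s1 r F B kappa' s s10 r0 Oy1 kk' Mloc).
have S0 : dotp (x0 - x0) (x0 - x0) = 0 by rewrite subrr dotp0.
(* The case [y1 = x0]. If [kappa < 0], testing with zero gradient gives [0 <= kappa]. Otherwise
   criticality in time gives [B = kappa' * (s1 - s)], so [chi s1 >= F], while the value at [x0] does
   not depend on time and is at most [F]: this contradicts [pos]. *)
case: kap => [kneg|[taup kpos]].
  have := @f_sub y1 0 0 (1 / s1) Oy1; rewrite dotp0 expr0n !mulr0 addr0 oppr0.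
  suff near : \forall y \near y1, f y <= f y1 + quadratic_test 0 0 (1 / s1) y1 y.
    by move=> /(_ near); rewrite leNgt kneg.
  have nearD : \forall y \near y1, D y.
    by apply: filterS OmegaD _; exact: open_nbhs_nbhs.
  apply: filterS nearD => y Dy.
  have := Mloc s1 y; rewrite subrr normr0 => /(_ r0 Dy).
  rewrite /penalized /quadratic_test (dotpC 0) dotp0 y1x0 S0 mul0r.
  have -> : dotp (y - x0) (y - x0) / (2 * s1) = 1 / s1 / 2 * dotp (y - x0) (y - x0).
    by field; rewrite gt_eqF.
  by rewrite expr0n; set c := _ / 2 * _; lra.
have crit := @penalized_time_critical x0 y1 s1 r F B kappa' s s10 r0
  (fun t tr => Mloc t y1 tr Dy1).
move: crit; rewrite y1x0 S0 mul0r => /eqP; rewrite subr_eq0 => /eqP BE.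
move: pos; rewrite /psi /chi y1x0 -/s1 BE /penalized S0 mul0r subr0.
have := x1M _ Dx0; rewrite /penalized S0 mul0r subr0.
have : 0 <= kappa' * (s1 - s) ^+ 2.
  by rewrite mulr_ge0 ?sqr_ge0//; lra.
by rewrite expr2; lra.
Qed.

End HopfLax.

(** * Expansions of the power 4/3 *)

Section FourthRoot.
Context {R : realType}.
Implicit Types x y c d : R.

(* Vanishes on negative reals, unlike [x `^ (1 / 4)] which is then 1. *)
Definition root4 x : R := Num.sqrt (Num.sqrt x).

Lemma root4_ge0 x : 0 <= root4 x. Proof. exact: sqrtr_ge0. Qed.

Lemma root4K x : 0 <= x -> root4 x ^+ 4 = x.
Proof.
by move=> x0; rewrite -[4%N]/(2 * 2)%N exprM sqr_sqrtr ?sqrtr_ge0// sqr_sqrtr.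
Qed.

Lemma ler_root4 x y : x <= y -> root4 x <= root4 y.
Proof. by move=> xy; rewrite !ler_wsqrtr. Qed.

Lemma root4_gt0 x : (0 < root4 x) = (0 < x).
Proof. by rewrite /root4 !sqrtr_gt0. Qed.

Lemma root4_le0 x : x <= 0 -> root4 x = 0.
Proof. by move=> x0; rewrite /root4 (ler0_sqrtr x0) sqrtr0. Qed.

(** Positivity of [x] matters because [root4] is constant on the nonpositive reals. *)
Lemma root4_cube_inj x y : root4 x ^+ 3 <= root4 y ^+ 3 -> 0 < x -> x <= y.
Proof.
move=> xy x0; rewrite leNgt; apply/negP => yx.
have [y0|y0] := leP y 0.
  move: xy; rewrite (root4_le0 y0) expr0n leNgt => /negP; apply.
  by rewrite exprn_gt0 ?root4_gt0.
move: xy; rewrite leNgt => /negP; apply.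
by rewrite ltr_pXn2r ?nnegrE ?root4_ge0// /root4 !ltr_sqrt ?sqrtr_gt0.
Qed.

Lemma continuous_root4 : continuous (root4 : R -> R).
Proof.
move=> x; apply: (@continuous_comp _ _ _ (@Num.sqrt R) (@Num.sqrt R));
  exact: sqrt_continuous.
Qed.

Lemma powR_three_quarters x : 0 <= x -> x `^ (3 / 4) = root4 x ^+ 3.
Proof.
move=> x0; rewrite /root4 -!powR12_sqrt ?powR_ge0//.
rewrite -powRrM -powR_mulrn ?powR_ge0// -powRrM; congr (_ `^ _); by field.
Qed.

(** Tangent inequality for the concave function [r^(3/4)] at [r = d^4], evaluated at [c^4]. *)
Lemma cube_le_tangent c d : 0 <= c -> 0 < d ->
  c ^+ 3 <= d ^+ 3 + 3 / 4 * (c ^+ 4 - d ^+ 4) / d.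
Proof.
move=> c0 d0.
have -> : d ^+ 3 + 3 / 4 * (c ^+ 4 - d ^+ 4) / d = c ^+ 3
    + (c - d) ^+ 2 * (3 * c ^+ 2 + 2 * c * d + d ^+ 2) / (4 * d).
  by field; rewrite gt_eqF.
rewrite lerDl; apply: divr_ge0; last by rewrite mulr_ge0 ?(ltW d0).
apply: mulr_ge0; first exact: sqr_ge0.
have := mulr_ge0 c0 (ltW d0); have := sqr_ge0 c; have := sqr_ge0 d; lra.
Qed.

(** With [a = c^3 - 1] this bounds [(1 + a)^(4/3)] by its first-order expansion plus [a^2]; the next
    lemma has the exact coefficient [2/9]. Both follow from polynomial factorisations in [c]. *)
Lemma fourth_power_le c : 0 <= c ->
  c ^+ 4 <= 1 + 4 / 3 * (c ^+ 3 - 1) + (c ^+ 3 - 1) ^+ 2.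
Proof.
move=> c0; rewrite -subr_ge0.
have -> : 1 + 4 / 3 * (c ^+ 3 - 1) + (c ^+ 3 - 1) ^+ 2 - c ^+ 4 =
    (c - 1) ^+ 2 * (c ^+ 4 + 2 * c ^+ 3 + 2 * c ^+ 2 + 4 / 3 * c + 2 / 3).
  by field.
by rewrite mulr_ge0 ?sqr_ge0// !addr_ge0 ?mulr_ge0 ?exprn_ge0 ?divr_ge0.
Qed.

Lemma fourth_power_taylor c : 0 <= c ->
  `|c ^+ 4 - (1 + 4 / 3 * (c ^+ 3 - 1) + 2 / 9 * (c ^+ 3 - 1) ^+ 2)|
  <= `|c ^+ 3 - 1| ^+ 3.
Proof.
move=> c0.
have -> : c ^+ 4 - (1 + 4 / 3 * (c ^+ 3 - 1) + 2 / 9 * (c ^+ 3 - 1) ^+ 2) =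
    - ((c - 1) ^+ 3 * ((2 * c ^+ 3 + 6 * c ^+ 2 + 3 * c + 1) / 9)) by field.
have -> : c ^+ 3 - 1 = (c - 1) * (c ^+ 2 + c + 1) by ring.
have c2 : 0 <= c ^+ 2 by exact: sqr_ge0.
have c3 : 0 <= c ^+ 3 by exact: exprn_ge0.
have q1 : 0 <= c ^+ 2 + c + 1 by lra.
have q2 : 0 <= (2 * c ^+ 3 + 6 * c ^+ 2 + 3 * c + 1) / 9 by lra.
rewrite normrN -normrX exprMn [leLHS]normrM [leRHS]normrM (ger0_norm q2).
rewrite (ger0_norm (exprn_ge0 3 q1)).
apply: ler_wpM2l => //.
rewrite -subr_ge0.
have -> : (c ^+ 2 + c + 1) ^+ 3 - (2 * c ^+ 3 + 6 * c ^+ 2 + 3 * c + 1) / 9 =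
   c ^+ 6 + 3 * c ^+ 5 + 6 * c ^+ 4 + 61 / 9 * c ^+ 3 + 48 / 9 * c ^+ 2
   + 24 / 9 * c + 8 / 9 by field.
by rewrite !addr_ge0 ?mulr_ge0 ?divr_ge0 ?exprn_ge0.
Qed.

Lemma cube_root_ex x : 0 <= x -> exists2 c, 0 <= c & c ^+ 3 = x.
Proof.
move=> x0; exists (x `^ 3^-1); first exact: powR_ge0.
by rewrite -powR_mulrn ?powR_ge0// -powRrM mulVf// powRr1.
Qed.

End FourthRoot.

(** The growth along the flow bounds [c^4] from below, and maximality bounds [c^3] from above.
    Together they force [h = tau P + O(tau^(3/2))], hence [c^3 - 1 = 3/4 tau N + O(tau^(3/2))], with
    constants depending only on [N] and [C]. *)
Lemma first_order_expansion {R : realType} n (N C : R) : 0 <= N -> 0 <= C ->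
  exists2 e, 0 < e & exists2 K, 0 <= K & forall (P h : 'rV[R]_n) (tau c : R),
    dotp P P = N -> 0 < tau < e -> 0 <= c -> dotp h h <= 1 ->
    1 + dotp h h / (2 * tau) + tau * N / 2 - tau ^+ 2 / 2 <= c ^+ 4 ->
    c ^+ 3 <= 1 + 3 / 4 * dotp P h + C * dotp h h ->
    (c ^+ 3 - 1 - 3 / 4 * (tau * N)) ^+ 2 <= K * tau ^+ 3.
Proof.
move=> N0 C0.
(* With [H = |h|^2], [E = |h - t P|^2] and [a = c^3 - 1], the constants serve in turn
   [a^2 <= K1 H + t^4], [E / (2 t) <= 2 t^2 + K2 H], [E <= K3 t^3], [H <= K4 t^2], and a remainder
   of size [K5 t^2]. *)
pose K1 := 2 * N + 2 * C ^+ 2.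
pose K2 := 2 * C + K1 + 1.
pose K3 := 8 + 8 * (K2 * N).
pose K4 := 2 * K3 + 2 * N.
pose K5 := C * K4 + K1 * K4 + 2.
have K10 : 0 <= K1 by rewrite addr_ge0 ?mulr_ge0 ?exprn_ge0.
have K20 : 1 <= K2 by rewrite /K2; lra.
have K2N : 0 <= K2 * N by rewrite mulr_ge0//; lra.
have K30 : 8 <= K3 by rewrite /K3; lra.
have K40 : 0 <= K4 by rewrite /K4; lra.
have CK4 : 0 <= C * K4 by exact: mulr_ge0.
have K1K4 : 0 <= K1 * K4 by exact: mulr_ge0.
have K50 : 0 <= K5 by rewrite /K5; lra.
exists (1 / (8 * K2)); first by rewrite divr_gt0//; lra.
exists (2 * (N * K3) + 2 * K5 ^+ 2).
  by rewrite addr_ge0 ?mulr_ge0 ?exprn_ge0//; lra.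
move=> P h t c PN /andP[t0 te] c0 H1 lo up.
set H := dotp h h in H1 lo up.
set m := dotp P h in up.
have H0 : 0 <= H := dotp_ge0 h.
have tK2 : t * K2 <= 1 / 8.
  by move: te; rewrite ltr_pdivlMr; lra.
have t1 : t <= 1 / 8 by apply: le_trans tK2; rewrite ler_peMr//; lra.
have mH : m ^+ 2 <= N * H by rewrite -PN; exact: CauchySchwarz_dotp.
(* Completing the square, [H / (2 t) + t N / 2 = m + E / (2 t)]. The linear term [m] cancels against
   the one in the upper bound, so only [E] remains to be estimated. *)
pose E := H - 2 * (t * m) + t ^+ 2 * N.
have EE : E = dotp (h - t *: P) (h - t *: P).
  by rewrite !dotpE -/H PN (dotpC h P) -/m /E; ring.
have E0 : 0 <= E by rewrite EE dotp_ge0.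
have mE : (m - t * N) ^+ 2 <= N * E.
  have := CauchySchwarz_dotp P (h - t *: P).
  by rewrite -EE PN dotpDr dotpNr dotpZr PN.
have HE : H <= 2 * E + 2 * (t ^+ 2 * N).
  have := dotp_ge0 (h - (2 * t) *: P).
  by rewrite !dotpE -/H PN (dotpC h P) -/m /E => HE; lra.
set a := c ^+ 3 - 1.
have t20 : 0 < t ^+ 2 by rewrite exprn_gt0.
have t30 : 0 < t ^+ 3 by rewrite exprn_gt0.
have t32 : t ^+ 3 <= t ^+ 2 by rewrite exprS ler_piMl ?(ltW t20)//; lra.
have t43 : t ^+ 4 <= t ^+ 3 by rewrite exprS ler_piMl ?(ltW t30)//; lra.
have up4 := fourth_power_le c0; rewrite -/a in up4.
pose eta := 3 / 4 * m + C * H.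
have a_eta : a <= eta by rewrite /a /eta; lra.
have Ht : H / (2 * t) = m - t * N / 2 + E / (2 * t).
  by rewrite /E; field; rewrite gt_eqF.
have a_lo : - (t ^+ 2 / 2) <= a.
  have : 1 - t ^+ 2 / 2 <= c ^+ 4.
    apply: le_trans lo.
    have : 0 <= H / (2 * t) by rewrite divr_ge0// mulr_ge0// ltW.
    have : 0 <= t * N by rewrite mulr_ge0// ltW.
    lra.
  have [c1|c1] := leP c 1.
    have : c ^+ 4 <= c ^+ 3 by rewrite exprS ler_piMl ?exprn_ge0.
    rewrite /a; lra.
  have : 1 <= c ^+ 3 by rewrite exprn_ege1// ltW.
  rewrite /a; lra.
have a2 : a ^+ 2 <= K1 * H + t ^+ 4.
  have CH : (C * H) ^+ 2 <= C ^+ 2 * H.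
    by rewrite exprMn ler_wpM2l ?sqr_ge0// expr2 ler_piMl.
  have eta2 : eta ^+ 2 <= K1 * H.
    have : 0 <= (3 / 4 * m - C * H) ^+ 2 by exact: sqr_ge0.
    rewrite /eta /K1; have := sqr_ge0 m; clear -mH CH; lra.
  have [a0|a0] := leP 0 a.
    have : a ^+ 2 <= eta ^+ 2.
      by rewrite ler_pXn2r ?nnegrE//; exact: le_trans a_eta.
    have : 0 < t ^+ 4 by rewrite exprn_gt0.
    lra.
  have : a ^+ 2 <= (t ^+ 2 / 2) ^+ 2.
    by rewrite -[a ^+ 2]sqrrN ler_pXn2r ?nnegrE//; clear -a0 a_lo t20; lra.
  have : 0 <= K1 * H by rewrite mulr_ge0.
  have : 0 < t ^+ 4 by rewrite exprn_gt0.
  rewrite exprMn -exprM; clear; lra.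
have E1 : E / (2 * t) <= 2 * t ^+ 2 + K2 * H.
  have : C * H * (4 / 3) <= 2 * C * H by have := mulr_ge0 C0 H0; clear; lra.
  have : E / (2 * t) + m - t ^+ 2 / 2 <= 4 / 3 * a + a ^+ 2.
    by have := le_trans lo up4; rewrite Ht; clear; lra.
  have -> : K2 * H = 2 * C * H + K1 * H + H by rewrite /K2; ring.
  move: a_eta; rewrite /eta; clear -a2 t43 t32 H0 t20; lra.
have {}E1 : E <= 4 * t ^+ 3 + 2 * (t * K2) * H.
  have : E / (2 * t) * (2 * t) <= (2 * t ^+ 2 + K2 * H) * (2 * t).
    by rewrite ler_wpM2r// mulr_ge0// ltW.
  rewrite divfK ?mulf_neq0 ?gt_eqF// => /le_trans; apply.
  have -> : (2 * t ^+ 2 + K2 * H) * (2 * t) = 4 * t ^+ 3 + 2 * (t * K2) * H by ring.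
  by [].
(* Insert [HE]; since [t * K2 <= 1 / 8], the resulting multiple of [E] is at most [E / 2] and is
   absorbed on the left. *)
have E2 : E <= K3 * t ^+ 3.
  have : 2 * (t * K2) * H <= 2 * (t * K2) * (2 * E + 2 * (t ^+ 2 * N)).
    apply: ler_wpM2l HE; rewrite !mulr_ge0 ?(ltW t0)//.
    exact: le_trans ler01 K20.
  have : t * K2 * E <= 1 / 8 * E by rewrite ler_wpM2r.
  have -> : 2 * (t * K2) * (2 * E + 2 * (t ^+ 2 * N)) =
     4 * (t * K2 * E) + 4 * (K2 * N) * t ^+ 3 by ring.
  rewrite /K3; clear -E1; lra.
have H4 : H <= K4 * t ^+ 2.
  have : K3 * t ^+ 3 <= K3 * t ^+ 2 by rewrite ler_wpM2l//; clear -K30; lra.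
  rewrite /K4; clear -HE E2; lra.
have {}a2 : a ^+ 2 <= (K1 * K4 + 1) * t ^+ 2.
  have : K1 * H <= K1 * K4 * t ^+ 2 by rewrite -mulrA ler_wpM2l.
  lra.
(* The error splits into [D1], of order [t^(3/2)] because [|h - t P|] is, and a rest [G] of order
   [t^2]. *)
pose D1 := 3 / 4 * (m - t * N).
have dlo : - (K5 * t ^+ 2) <= a - 3 / 4 * (t * N) - D1.
  have : 4 / 3 * a >= m - t ^+ 2 / 2 - a ^+ 2.
    have := le_trans lo up4; rewrite Ht.
    have : 0 <= E / (2 * t) by rewrite divr_ge0// mulr_ge0// ltW.
    lra.
  have : 0 <= C * K4 * t ^+ 2 by rewrite mulr_ge0// ltW.
  have : 0 <= K1 * K4 * t ^+ 2 by rewrite mulr_ge0// ltW.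
  rewrite /D1 /K5; clear -a2 t20; lra.
have dup : a - 3 / 4 * (t * N) - D1 <= K5 * t ^+ 2.
  have : C * H <= C * K4 * t ^+ 2 by rewrite -mulrA ler_wpM2l.
  have : 0 <= K1 * K4 * t ^+ 2 by rewrite mulr_ge0// ltW.
  move: a_eta; rewrite /eta /D1 /K5; clear -t20; lra.
set G := a - _ - D1 in dlo dup.
have G2 : G ^+ 2 <= K5 ^+ 2 * t ^+ 3.
  have : G ^+ 2 <= (K5 * t ^+ 2) ^+ 2.
    rewrite -subr_ge0 subr_sqr; apply: mulr_ge0; first by rewrite subr_ge0.
    by rewrite -[G]opprK subr_ge0 lerNl.
  rewrite exprMn -exprM => /le_trans; apply.
  by rewrite ler_wpM2l// sqr_ge0.
have D2 : D1 ^+ 2 <= N * K3 * t ^+ 3.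
  have : N * E <= N * K3 * t ^+ 3 by rewrite -mulrA ler_wpM2l.
  have := sqr_ge0 (m - t * N).
  rewrite /D1 exprMn; clear -mE; lra.
have -> : a - 3 / 4 * (t * N) = G + D1 by rewrite /G subrK.
have := sqr_ge0 (G - D1); clearbody G D1; clear -G2 D2; lra.
Qed.

(* [cA^3], [cB^3], [cC^3] are the ratios of the regularised [w] after and before
   the displacement of the three points, [k > 1] is the ratio of
   [t1 w(x) + t2 w(y)] to [w(z)], and the clock at [z] runs [k] times faster. *)
Lemma second_order_contradiction {R : realType} (k N K th1 th2 : R) :
  1 < k -> 0 <= N -> 0 <= K -> 0 <= th1 -> 0 <= th2 -> th1 + th2 = 1 ->
  exists2 e, 0 < e & forall tau cA cB cC HA HB HM : R,
    0 < tau < e -> 0 <= cA -> 0 <= cB -> 0 <= cC ->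
    (cA ^+ 3 - 1 - 3 / 4 * (tau * N)) ^+ 2 <= K * tau ^+ 3 ->
    (cB ^+ 3 - 1 - 3 / 4 * (tau * N)) ^+ 2 <= K * tau ^+ 3 ->
    1 + HA / (2 * tau) + tau * N / 2 - tau ^+ 2 / 2 <= cA ^+ 4 ->
    1 + HB / (2 * tau) + tau * N / 2 - tau ^+ 2 / 2 <= cB ^+ 4 ->
    HM <= th1 * HA + th2 * HB ->
    cC ^+ 4 <= 1 + k * (tau * N / 2) - k ^+ 2 * tau ^+ 2 / 2 + k * (HM / (2 * tau)) ->
    k * (th1 * (cA ^+ 3 - 1) + th2 * (cB ^+ 3 - 1)) <= cC ^+ 3 - 1 ->
    False.
Proof.
move=> k1 N0 K0 th10 th20 thE.
have th2E : th2 = 1 - th1 by rewrite -thE addrAC subrr add0r.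
(* [M * tau] bounds the increments of the cubes at the first two points, and [K'] collects the
   third-order terms. The smallness of [tau] is chosen against the final inequality
   [(k^2 - k) tau^2 / 2 <= K' tau^3]. *)
pose M := 1 + (2 * N ^+ 2 + 2 * K).
have N20 : 0 <= N ^+ 2 by exact: sqr_ge0.
have M1 : 1 <= M by rewrite /M; lra.
have M3 : 0 < M ^+ 3 by rewrite exprn_gt0//; lra.
pose K' := k * K + (k + k ^+ 3) * M ^+ 3.
have k3 : 0 < k ^+ 3 by rewrite exprn_gt0//; lra.
have K'0 : 0 < K'.
  by rewrite ltr_wpDl ?mulr_ge0// ?mulr_gt0//; lra.
have kk : 0 < k ^+ 2 - k by rewrite subr_gt0 expr2 ltr_pMl//; lra.
exists (Num.min 1 (Num.min (1 / (k * M)) ((k ^+ 2 - k) / (2 * K')))).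
  by rewrite !lt_min ltr01 !divr_gt0 ?mulr_gt0//; lra.
move=> t cA cB cC HA HB HM /andP[t0]; rewrite !lt_min => /and3P[t1 tM tK].
move=> cA0 cB0 cC0 expA expB loA loB HMle upC kle.
have {}tM : k * M * t <= 1.
  have kM : 0 < k * M by rewrite mulr_gt0// (lt_le_trans ltr01)// ltW.
  by move: tM; rewrite ltr_pdivlMr// mulrC => /ltW.
have {}tK : K' * t < (k ^+ 2 - k) / 2.
  by move: tK; rewrite ltr_pdivlMr ?mulr_gt0//; clear; lra.
have t20 : 0 < t ^+ 2 by rewrite exprn_gt0.
have t30 : 0 < t ^+ 3 by rewrite exprn_gt0.
have t32 : t ^+ 3 <= t ^+ 2 by rewrite exprS ler_piMl ?(ltW t20)//; lra.
set a := cA ^+ 3 - 1 in expA kle; set b := cB ^+ 3 - 1 in expB kle.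
have small x : (x - 3 / 4 * (t * N)) ^+ 2 <= K * t ^+ 3 -> `|x| <= M * t.
  move=> xK; rewrite -(@ler_pXn2r _ 2) ?nnegrE ?mulr_ge0 ?(ltW t0)//; last by lra.
  rewrite real_normK ?num_real// exprMn.
  have MM : M * t ^+ 2 <= M ^+ 2 * t ^+ 2.
    by rewrite ler_pM2r// expr2 ler_pMl//; lra.
  have : K * t ^+ 3 <= K * t ^+ 2 by rewrite ler_wpM2l.
  have := sqr_ge0 (x - 3 / 4 * (t * N) - 3 / 4 * (t * N)).
  have : 0 <= N ^+ 2 * t ^+ 2 by rewrite mulr_ge0// ltW.
  have ME : M * t ^+ 2 = t ^+ 2 + 2 * (N ^+ 2 * t ^+ 2) + 2 * (K * t ^+ 2).
    by rewrite /M; ring.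
  move: MM; rewrite ME; lra.
have sa := small _ expA; have sb := small _ expB.
pose y0 := k * (th1 * a + th2 * b).
have sy : `|y0| <= k * (M * t).
  rewrite /y0 normrM gtr0_norm; last by lra.
  rewrite ler_wpM2l//; first by lra.
  apply: (le_trans (ler_normD _ _)); rewrite !normrM (ger0_norm th10) (ger0_norm th20).
  have : th1 * `|a| <= th1 * (M * t) by rewrite ler_wpM2l.
  have : th2 * `|b| <= th2 * (M * t) by rewrite ler_wpM2l.
  rewrite th2E.
  lra.
(* [cC] is only bounded from below, so the expansion is made at the smaller [c0], whose cube is
   known exactly. It exists because [|y0| <= k * M * t <= 1]. *)
have [c0 c00 c03] : exists2 c, 0 <= c & c ^+ 3 = 1 + y0.
  apply: cube_root_ex; have := ler_norm (- y0); rewrite normrN; clear -sy tM; lra.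
have c0C : c0 <= cC.
  rewrite -(@ler_pXn2r _ 3) ?nnegrE// c03; move: kle; rewrite -/y0; lra.
have c0C4 : c0 ^+ 4 <= cC ^+ 4 by rewrite ler_pXn2r ?nnegrE.
have tay (x c : R) : 0 <= c -> c ^+ 3 - 1 = x -> forall B : R, `|x| <= B ->
    `|c ^+ 4 - (1 + 4 / 3 * x + 2 / 9 * x ^+ 2)| <= B ^+ 3.
  move=> cge <- B xB; apply: le_trans (fourth_power_taylor cge) _.
  rewrite ler_pXn2r ?nnegrE//; exact: le_trans (normr_ge0 _) xB.
have := tay y0 c0 c00; rewrite c03 addrC addKr => /(_ erefl _ sy).
have := tay a cA cA0 erefl _ sa; have := tay b cB cB0 erefl _ sb.
rewrite !ler_norml => /andP[_ tB] /andP[_ tA] /andP[tC _].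
set ca := cA ^+ 4 in loA tA; set cb := cB ^+ 4 in loB tB.
have avgA : th1 * (1 + HA / (2 * t) + t * N / 2 - t ^+ 2 / 2) <=
   th1 * (1 + 4 / 3 * a + 2 / 9 * a ^+ 2 + (M * t) ^+ 3).
  by rewrite ler_wpM2l//; clear -loA tA; lra.
have avgB : th2 * (1 + HB / (2 * t) + t * N / 2 - t ^+ 2 / 2) <=
   th2 * (1 + 4 / 3 * b + 2 / 9 * b ^+ 2 + (M * t) ^+ 3).
  by rewrite ler_wpM2l//; clear -loB tB; lra.
have HMt : HM / (2 * t) <= th1 * (HA / (2 * t)) + th2 * (HB / (2 * t)).
  by rewrite !mulrA -mulrDl ler_wpM2r// invr_ge0 mulr_ge0// ltW.
(* The average of the squares exceeds the square of the average by a variance term; it is of third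
   order because [a] and [b] share the leading part [3 / 4 * (t * N)]. *)
have ab2 : (a - b) ^+ 2 <= 4 * (K * t ^+ 3).
  have := sqr_ge0 (a - 3 / 4 * (t * N) + (b - 3 / 4 * (t * N))).
  by clear -expA expB; lra.
have th12 : th1 * th2 * (a - b) ^+ 2 <= (a - b) ^+ 2.
  rewrite ler_piMl ?sqr_ge0// -thE.
  clear -th10 th20 thE; nra.
have varE : th1 * a ^+ 2 + th2 * b ^+ 2 =
    (th1 * a + th2 * b) ^+ 2 + th1 * th2 * (a - b) ^+ 2.
  rewrite th2E.
  ring.
set av := th1 * a + th2 * b in varE.
have av0 : 0 <= av ^+ 2 by exact: sqr_ge0.
have S1 : HM / (2 * t) + t * N / 2 - t ^+ 2 / 2 <=
    4 / 3 * av + 2 / 9 * (av ^+ 2 + 4 * (K * t ^+ 3)) + M ^+ 3 * t ^+ 3.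
  rewrite -exprMn; set B3 := (M * t) ^+ 3 in avgA avgB *.
  have V : th1 * (2 / 9 * a ^+ 2) + th2 * (2 / 9 * b ^+ 2) <=
      2 / 9 * (av ^+ 2 + 4 * (K * t ^+ 3)).
    have -> : th1 * (2 / 9 * a ^+ 2) + th2 * (2 / 9 * b ^+ 2) =
      2 / 9 * (th1 * a ^+ 2 + th2 * b ^+ 2) by ring.
    rewrite varE ler_wpM2l// lerD2l; exact: le_trans th12 ab2.
  have e1 (z : R) : z = th1 * z + th2 * z by rewrite -mulrDl thE mul1r.
  rewrite (e1 (t * N / 2)) (e1 (t ^+ 2 / 2)) (e1 B3).
  have avE : av = th1 * a + th2 * b by [].
  clearbody av; clear -V avgA avgB HMt avE; lra.
have S2 : 4 / 3 * (k * av) + 2 / 9 * (k ^+ 2 * av ^+ 2) - k ^+ 3 * (M ^+ 3 * t ^+ 3) <=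
    k * (t * N / 2) - k ^+ 2 * t ^+ 2 / 2 + k * (HM / (2 * t)).
  move: tC; rewrite /y0 -/av !exprMn; clear -upC c0C4; lra.
have S3 := ler_wpM2l (ltW (lt_trans ltr01 k1)) S1.
(* In [k] times [S1] against [S2] the terms in [HM], [N] and [av] cancel. The quadratic terms in
   [av] leave [(k - k^2) av^2], which is nonpositive since [k > 1]. *)
have : (k ^+ 2 - k) * t ^+ 2 / 2 <= K' * t ^+ 3.
  have : 0 <= (k ^+ 2 - k) * av ^+ 2 by rewrite mulr_ge0// ltW.
  have : 0 <= k * (K * t ^+ 3) by rewrite mulr_ge0// ?mulr_ge0// ltW// (lt_trans ltr01).
  rewrite /K'; clear -S2 S3 th12 ab2; lra.
have : K' * t * t ^+ 2 < (k ^+ 2 - k) / 2 * t ^+ 2 by rewrite ltr_pM2r.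
rewrite -mulrA -exprS; clear; lra.
Qed.

(** * The flows of sub- and supersolutions at a contact point *)

Section Gradient.
Context {R : realType} {n : nat}.
Variables (Omega D : set 'rV[R]_n) (g : 'rV[R]_n -> R).
Hypothesis Omega_open : open Omega.
Hypothesis OmegaD : Omega `<=` D.

Lemma penalized_shift (f : 'rV[R]_n -> R) x0 x1 q s : s != 0 ->
  penalized f (x0 + q) s x1 =
  penalized f x0 s x1 + dotp (s^-1 *: (x1 - x0)) q - dotp q q / (2 * s).
Proof.
move=> s0; rewrite /penalized opprD addrA.
move: (x1 - x0) => v; rewrite !dotpE (dotpC q v); field; exact: s0.
Qed.

Lemma penalized_center (f : 'rV[R]_n -> R) x0 s : penalized f x0 s x0 = f x0.
Proof. by rewrite /penalized subrr dotp0 mul0r subr0. Qed.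

(** With [x1] frozen, the penalized value is a quadratic function of [q] with gradient
    [xi = s^-1 (x1 - x0)] at [q = 0], so its power [3/4] has gradient [3/4 xi / a]. The upper bound
    touches this power at [q = 0], hence the gradients agree. The proof moves [q] along
    [v = xi - a P]. *)
Lemma gradient_of_upper_bound x0 x1 s P (C : R) : Omega x0 -> D x1 -> 0 < s ->
  let X := penalized g x0 s x1 in let a := root4 X in 0 < X -> 0 <= C ->
  (forall q, D (x0 + q) ->
    root4 (penalized g (x0 + q) s x1) ^+ 3 <=
      a ^+ 3 + 3 / 4 * dotp P q + C * dotp q q) ->
  s^-1 *: (x1 - x0) = a *: P.
Proof.
move=> Ox0 Dx1 s0 X a X0 C0 F.
apply/eqP; rewrite -subr_eq0 -dotp_eq0; apply/eqP.
have sn0 : s != 0 by rewrite gt_eqF.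
have [xi xiE] : {xi | xi = s^-1 *: (x1 - x0)} by eexists; reflexivity.
have [v vE] : {v | v = xi - a *: P} by eexists; reflexivity.
rewrite -xiE -vE.
have a0 : 0 < a by rewrite root4_gt0.
have a4 : a ^+ 4 = X by apply: root4K; exact: ltW.
have [e e0 eD] : exists2 e : R, 0 < e & forall y, dotp (y - x0) (y - x0) < e -> D y.
  apply/nbhs_dotpP; apply: filterS OmegaD _; exact: open_nbhs_nbhs.
set V := dotp v v.
have V0 : 0 <= V := dotp_ge0 v.
pose b := dotp xi v.
pose m := dotp P v.
have Vbm : V = b - a * m by rewrite /V {1}vE dotpDl dotpNl dotpZl.
(* At [q = t v] with [|t| < 1], [|t| k1] bounds the change of the penalized value and [|t| k2] that
   of its fourth root; the division by [a^3] comes from factoring [c^4 - a^4]. *)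
pose k1 := `|b| + V / (2 * s).
have k10 : 0 <= k1 by rewrite addr_ge0// divr_ge0// mulr_ge0// ltW.
pose k2 := k1 / a ^+ 3.
have k20 : 0 <= k2 by rewrite divr_ge0// exprn_ge0// ltW.
pose K := V / (2 * s) + `|m| * k2 + 4 / 3 * C * V * (a + k2).
(* AM-GM [(3/4) (c^4 - a^4) <= c (c^3 - a^3)] turns the bound on cubes into one
   on fourth powers, up to second order in [t]. *)
have key t : `|t| < Num.min 1 (e / (V + 1)) -> t * V <= K * t ^+ 2.
  rewrite lt_min => /andP[t1 te].
  have t2 : t ^+ 2 = `|t| ^+ 2 by rewrite real_normK ?num_real.
  have t2le : t ^+ 2 <= `|t| by rewrite t2 expr2 ler_piMl// ltW.
  have Dq : D (x0 + t *: v).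
    apply: eD; rewrite addrC addKr !dotpE -/V mulrA -expr2.
    move: te; rewrite ltr_pdivlMr; last by lra.
    have := normr_ge0 t; have : t ^+ 2 * V <= `|t| * V by rewrite ler_wpM2r.
    lra.
  have := F _ Dq; rewrite penalized_shift// -xiE -/X !dotpE -/V -/b -/m.
  pose dl := t * b - t * (t * V) / (2 * s).
  rewrite -addrA -/dl.
  have dlk : `|dl| <= `|t| * k1.
    apply: (le_trans (ler_normB _ _)); rewrite /k1 mulrDr normrM lerD2l.
    rewrite mulrA -expr2 ger0_norm; last first.
      by apply: divr_ge0; rewrite mulr_ge0 ?sqr_ge0// ltW.
    rewrite -mulrA; apply: ler_wpM2r t2le.
    by rewrite divr_ge0// mulr_ge0// ltW.
  set c := root4 _ => Fc.
  have c0 : 0 <= c := root4_ge0 _.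
  have XdlE : X + dl <= c ^+ 4.
    have [p|p] := leP 0 (X + dl); first by rewrite /c root4K.
    by apply: le_trans (ltW p) _; exact: exprn_ge0.
  have ca : c <= a + `|t| * k2.
    have [c_le|a_lt] := leP c a.
      by apply: le_trans c_le _; rewrite lerDl; apply: mulr_ge0.
    have Xdl0 : 0 < X + dl.
      rewrite -root4_gt0 -/c; exact: lt_trans a0 a_lt.
    have c4 : c ^+ 4 = X + dl by rewrite /c root4K// ltW.
    rewrite -lerBlDl /k2 mulrA ler_pdivlMr ?exprn_gt0//.
    apply: le_trans dlk; apply: le_trans (ler_norm dl).
    have -> : dl = (c - a) * (c ^+ 3 + c ^+ 2 * a + c * a ^+ 2 + a ^+ 3).
      have -> : dl = c ^+ 4 - a ^+ 4 by rewrite c4 a4 addrC addKr.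
      ring.
    apply: ler_wpM2l; first by rewrite subr_ge0 ltW.
    by rewrite lerDr !addr_ge0 ?mulr_ge0 ?exprn_ge0// ltW.
  have ca' : a - `|t| * k2 <= c.
    have [a_le|c_lt] := leP a c.
      by apply: le_trans a_le; rewrite gerBl; apply: mulr_ge0.
    rewrite lerBlDr addrC -lerBlDr /k2 mulrA ler_pdivlMr ?exprn_gt0//.
    apply: le_trans dlk; rewrite -normrN; apply: le_trans (ler_norm (- dl)).
    apply: (@le_trans _ _ (a ^+ 4 - c ^+ 4)); last by rewrite a4; lra.
    have -> : a ^+ 4 - c ^+ 4 =
      (a - c) * (c ^+ 3 + c ^+ 2 * a + c * a ^+ 2 + a ^+ 3) by ring.
    apply: ler_wpM2l; first by rewrite subr_ge0 ltW.
    by rewrite lerDr !addr_ge0 ?mulr_ge0 ?exprn_ge0// ltW.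
  have amgm : 3 / 4 * (c ^+ 4 - a ^+ 4) <= c * (c ^+ 3 - a ^+ 3).
    rewrite -subr_ge0.
    have -> : c * (c ^+ 3 - a ^+ 3) - 3 / 4 * (c ^+ 4 - a ^+ 4) =
      (c - a) ^+ 2 * ((c + a) ^+ 2 + 2 * a ^+ 2) / 4 by field.
    by rewrite divr_ge0// mulr_ge0 ?sqr_ge0// addr_ge0 ?sqr_ge0// mulr_ge0 ?sqr_ge0.
  have s1 : c * (c ^+ 3 - a ^+ 3) <= c * (3 / 4 * (t * m) + C * (t * (t * V))).
    by apply: ler_wpM2l => //; lra.
  have s2 : dl <= c * (t * m) + 4 / 3 * (C * V) * (t ^+ 2 * c).
    by rewrite -a4 in XdlE; lra.
  have s3 : c * (t * m) <= a * (t * m) + `|m| * k2 * t ^+ 2.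
    have : (c - a) * (t * m) <= `|t| * k2 * (`|t| * `|m|).
      apply: (le_trans (ler_norm _)); rewrite !normrM.
      apply: ler_wpM2r; first by rewrite mulr_ge0.
      by rewrite ler_norml; apply/andP; split; lra.
    rewrite t2; lra.
  have s4 : t ^+ 2 * c <= t ^+ 2 * (a + k2).
    apply: ler_wpM2l; first exact: sqr_ge0.
    by apply: le_trans ca _; rewrite lerD2l ler_piMl// ltW.
  have CV : 0 <= C * V by exact: mulr_ge0.
  have s5 := ler_wpM2l CV s4.
  have : dl = t * b - t ^+ 2 * (V / (2 * s)) by rewrite /dl; ring.
  have tV : t * V = t * b - a * (t * m) by rewrite Vbm; ring.
  rewrite /K; set Vs := V / _ => dlE.
  clear -dlE tV s2 s3 s5; clearbody V dl c Vs; lra.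
have r0 : 0 < Num.min 1 (e / (V + 1)).
  by rewrite lt_min ltr01 divr_gt0//; lra.
apply/eqP; rewrite -oppr_eq0; apply/eqP.
apply: (@linear_coef_eq0 _ _ K _ r0) => t /key; lra.
Qed.

End Gradient.

Section PointSteps.
Context {R : realType} {n : nat}.
Variables (Omega D : set 'rV[R]_n) (g : 'rV[R]_n -> R).
Hypothesis Omega_open : open Omega.
Hypothesis OmegaD : Omega `<=` D.
Hypothesis D_compact : compact D.
Hypothesis g_cont : continuous g.
Hypothesis g_gt0 : forall x, Omega x -> 0 < g x.
Hypothesis g_eq0 : forall x, D x -> ~ Omega x -> g x = 0.

(** [hopf_lax_step] is run for the extra time [sg = tau a^2], which is then traded for a
    displacement [q = a^3 h] of the centre at the original time [s]. The upper bound [F] identifies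
    the gradient as [a P] and feeds [first_order_expansion]. *)
Lemma subsolution_step x0 x1 s P (C : R) :
  quadratic_subsolution Omega 1 g -> Omega x0 -> D x1 -> 0 < s ->
  (forall y, D y -> penalized g x0 s y <= penalized g x0 s x1) ->
  let a := root4 (penalized g x0 s x1) in 0 <= C ->
  (forall q x', D (x0 + q) -> D x' ->
    root4 (penalized g (x0 + q) s x') ^+ 3 <=
      a ^+ 3 + 3 / 4 * dotp P q + C * dotp q q) ->
  exists2 e, 0 < e & exists2 K, 0 <= K & forall tau, 0 < tau < e ->
    exists h x2 c, [/\ D (x0 + a ^+ 3 *: h), D x2, 0 <= c &
     [/\ root4 (penalized g (x0 + a ^+ 3 *: h) s x2) = a * c,
      1 + dotp h h / (2 * tau) + tau * dotp P P / 2 - tau ^+ 2 / 2 <= c ^+ 4 &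
      (c ^+ 3 - 1 - 3 / 4 * (tau * dotp P P)) ^+ 2 <= K * tau ^+ 3]].
Proof.
move=> gsub Ox0 Dx1 s0 x1M a C0 F.
have Dx0 : D x0 := OmegaD Ox0.
have X0 : 0 < penalized g x0 s x1.
  by apply: lt_le_trans (x1M _ Dx0); rewrite penalized_center g_gt0.
have a0 : 0 < a by rewrite root4_gt0.
have a4 : a ^+ 4 = penalized g x0 s x1 by apply: root4K; exact: ltW.
have xiE : s^-1 *: (x1 - x0) = a *: P.
  apply: (@gradient_of_upper_bound R n Omega D g Omega_open OmegaD x0 x1 s P C) => //.
  by move=> q Dq; exact: F.
set N := dotp P P.
have p2E : dotp (x1 - x0) (x1 - x0) / s ^+ 2 = a ^+ 2 * N.
  have := congr1 (fun v => dotp v v) xiE; rewrite !(dotpZl, dotpZr) -/N => H.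
  by rewrite expr2 -mulrA -H; field; rewrite gt_eqF.
have a30 : 0 < a ^+ 3 by rewrite exprn_gt0.
have [e1 e10 [K K0 HK]] := @first_order_expansion R n N (C * a ^+ 3)
  (dotp_ge0 _) (mulr_ge0 C0 (ltW a30)).
have D0 : D !=set0 by exists x0.
have [xm Dxm xmM] := compact_max D0 D_compact g_cont.
have gm0 : 0 < g xm by apply: lt_le_trans (xmM _ Dx0); exact: g_gt0.
have [r r0 rD] : exists2 r : R, 0 < r & forall y, dotp (y - x0) (y - x0) < r -> D y.
  apply/nbhs_dotpP; apply: filterS OmegaD _; exact: open_nbhs_nbhs.
pose B := g xm / a ^+ 4 + 1.
have B0 : 0 < B by rewrite addr_gt0// divr_gt0// exprn_gt0.
(* Since values of [g] are at most [g xm], the displacement satisfies [|h|^2 <= 2 B tau]; the last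
   two bounds give [|h| <= 1] and keep the displaced centre in [D]. *)
pose e := Num.min (Num.min 1 e1) (Num.min (1 / (2 * B)) (r / (2 * B * a ^+ 6))).
have e0 : 0 < e.
  by rewrite !lt_min ltr01 e10 !divr_gt0// !mulr_gt0// exprn_gt0.
exists e => //; exists K => // tau /andP[tau0].
rewrite !lt_min => /andP[/andP[tau1 taue1] /andP[tauB taur]].
pose sg := tau * a ^+ 2.
have sg0 : 0 < sg by rewrite mulr_gt0// exprn_gt0.
have ssg0 : 0 < s + sg by rewrite addr_gt0.
have [||x2 Dx2] := @hopf_lax_step R n Omega D g 1 Omega_open OmegaD D_compact
    g_cont gsub x0 x1 s sg Dx0 Dx1 s0 ssg0 (lt0r_neq0 sg0) _ x1M.
- by right.
(* Where [g] vanishes the penalized value is at most [0], less than [g x0], the value at the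
   centre. *)
- move=> t y1 /andP[t0 _] Dy1 y1M; apply: contrapT => nO.
  have tsg0 : 0 < s + t * sg by rewrite addr_gt0// mulr_gt0.
  have := y1M _ Dx0; rewrite penalized_center /penalized (g_eq0 Dy1 nO) sub0r.
  apply/negP; rewrite -ltNge; apply: le_lt_trans (g_gt0 Ox0).
  by rewrite oppr_le0 divr_ge0 ?dotp_ge0// mulr_ge0// ltW.
rewrite p2E -a4 mul1r => lo.
pose w := x2 - x0.
(* The point of the segment from [x0] to [x2] reached after time [sg] out of [s + sg]: there the
   two-stage cost equals the direct cost, so recentring gains exactly [Q / (2 * sg)]. *)
have [q qE] : {q | q = (sg / (s + sg)) *: w} by eexists; reflexivity.
have [Q QE] : {Q | Q = dotp q q} by eexists; reflexivity.
have Q0 : 0 <= Q by rewrite QE dotp_ge0.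
have betaE : penalized g (x0 + q) s x2 = penalized g x0 (s + sg) x2 + Q / (2 * sg).
  rewrite /penalized opprD addrA -/w QE dotp_sub_sqr qE !(dotpZl, dotpZr).
  by field; rewrite !gt_eqF.
have [beta bE] : {beta | beta = penalized g (x0 + q) s x2} by eexists; reflexivity.
have a60 : 0 < a ^+ 6 by rewrite exprn_gt0.
have a40 : 0 < a ^+ 4 by rewrite exprn_gt0.
have {betaE} blo : a ^+ 4 * (1 + Q / a ^+ 6 / (2 * tau) + tau * N / 2 - tau ^+ 2 / 2)
    <= beta.
  have -> : a ^+ 4 * (1 + Q / a ^+ 6 / (2 * tau) + tau * N / 2 - tau ^+ 2 / 2) =
     a ^+ 4 + sg * (a ^+ 2 * N) / 2 - sg ^+ 2 / 2 + Q / (2 * sg).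
    by rewrite /sg; field; rewrite !gt_eqF.
  by rewrite bE betaE lerD2r.
have tau2 : tau ^+ 2 <= 1 by rewrite exprn_ile1// ltW.
have N0 : 0 <= tau * N by rewrite mulr_ge0 ?dotp_ge0// ltW.
have Qt0 : 0 <= Q / a ^+ 6 / (2 * tau).
  by rewrite !divr_ge0 ?mulr_ge0// ltW.
have b0 : 0 < beta.
  by apply: lt_le_trans blo; rewrite mulr_gt0//; lra.
have bup : beta <= g xm.
  apply: le_trans (xmM _ Dx2); rewrite bE /penalized gerBl.
  by rewrite divr_ge0 ?dotp_ge0// mulr_ge0// ltW.
have Qle : Q / a ^+ 6 <= 2 * B * tau.
  have := le_trans blo bup; rewrite mulrC -ler_pdivlMr// => H.
  have : Q / a ^+ 6 / (2 * tau) <= B by rewrite /B; lra.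
  rewrite ler_pdivrMr ?mulr_gt0//; lra.
have B2 : 0 < 2 * B by rewrite mulr_gt0.
have [h hE] : {h | h = (a ^+ 3)^-1 *: q} by eexists; reflexivity.
have hq : a ^+ 3 *: h = q by rewrite hE scalerA divff ?scale1r// gt_eqF.
have hh : dotp h h = Q / a ^+ 6.
  by rewrite hE !(dotpZl, dotpZr) -QE; field; rewrite gt_eqF.
have Dq : D (x0 + q).
  apply: rD; rewrite addrC addKr -QE.
  move: taur; rewrite ltr_pdivlMr ?mulr_gt0//; move: Qle.
  rewrite ler_pdivrMr//; lra.
have rb4 : root4 beta ^+ 4 = beta by apply: root4K; exact: ltW.
exists h, x2, (root4 beta / a); rewrite hq -bE hh.
have c4 : (root4 beta / a) ^+ 4 = beta / a ^+ 4 by rewrite expr_div_n rb4.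
have lo' : 1 + Q / a ^+ 6 / (2 * tau) + tau * N / 2 - tau ^+ 2 / 2 <=
    (root4 beta / a) ^+ 4.
  by rewrite c4 ler_pdivlMr// mulrC.
have c0 : 0 <= root4 beta / a by rewrite divr_ge0 ?root4_ge0// ltW.
split => //; split => //; first by field; rewrite gt_eqF.
apply: (HK P h tau) => //; rewrite ?hh//.
- by rewrite tau0.
- apply: le_trans Qle _; move: tauB; rewrite ltr_pdivlMr//; lra.
- have := F q x2 Dq Dx2; rewrite -bE => Fb.
  rewrite expr_div_n ler_pdivrMr//; apply: le_trans Fb _.
  rewrite -hq !(dotpZl, dotpZr) hh le_eqVlt; apply/orP; left; apply/eqP.
  by field; rewrite gt_eqF.
Qed.

(** For the inf-convolution the time is decreased from [s] to [s - sg], with [sg = tau d^2], and the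
    time saved pays for a displacement of the centre by [dotp_split_le]. The same [z2] serves every
    [h], so the displacement can be prescribed afterwards by the two other points. *)
Lemma supersolution_step z0 z1 s P (d : R) :
  quadratic_subsolution Omega (-1) (fun x => - g x) -> D z0 -> D z1 -> 0 < s ->
  let ng x := - g x in
  (forall y, D y -> penalized ng z0 s y <= penalized ng z0 s z1) ->
  (forall t y1, 0 < t <= s -> D y1 ->
    (forall y, D y -> penalized ng z0 t y <= penalized ng z0 t y1) -> Omega y1) ->
  - penalized ng z0 s z1 = d ^+ 4 -> 0 < d -> s^-1 *: (z0 - z1) = d *: P ->
  forall tau, 0 < tau -> tau * d ^+ 2 < s ->
    exists2 z2, D z2 & forall h, - penalized ng (z0 + d ^+ 3 *: h) s z2 <=
      d ^+ 4 * (1 + tau * dotp P P / 2 - tau ^+ 2 / 2 + dotp h h / (2 * tau)).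
Proof.
move=> gsup Dz0 Dz1 s0 ng z1M int Zd d0 zetaE tau tau0 taus.
set N := dotp P P.
have p2E : dotp (z1 - z0) (z1 - z0) / s ^+ 2 = d ^+ 2 * N.
  have := congr1 (fun v => dotp v v) zetaE; rewrite !(dotpZl, dotpZr) -/N => H.
  rewrite expr2 -mulrA -H -(opprB z0 z1) dotpNl dotpNr opprK.
  by field; rewrite gt_eqF.
pose sg := tau * d ^+ 2.
have sg0 : 0 < sg by rewrite mulr_gt0// exprn_gt0.
have ssg0 : 0 < s + - sg by rewrite subr_gt0.
have nsg0 : - sg != 0 by rewrite oppr_eq0 gt_eqF.
have cng : continuous ng by move=> x; apply: continuousN; exact: g_cont.
have [||z2 Dz2] := @hopf_lax_step R n Omega D ng (-1) Omega_open OmegaD D_compact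
    cng gsup z0 z1 s (- sg) Dz0 Dz1 s0 ssg0 nsg0 _ z1M.
- by left; rewrite oppr_lt0.
- move=> t y1 /andP[t0 t1]; apply: int; apply/andP; split; last first.
    by rewrite gerDl mulrN oppr_le0 mulr_ge0// ltW.
  have : t * sg < sg by rewrite gtr_pMl.
  lra.
rewrite p2E => lo; exists z2 => // h.
have := dotp_split_le (z2 - z0) (d ^+ 3 *: h) ssg0 sg0.
rewrite subrK !(dotpZl, dotpZr) => split.
have Fz : penalized ng z0 s z1 = - d ^+ 4 by rewrite -Zd opprK.
rewrite {2}/penalized Fz sqrrN in lo.
rewrite /penalized (opprD z0) (addrA z2).
have -> : d ^+ 4 * (1 + tau * N / 2 - tau ^+ 2 / 2 + dotp h h / (2 * tau)) =
  d ^+ 4 + sg * (d ^+ 2 * N) / 2 - sg ^+ 2 / 2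
  + d ^+ 3 * (d ^+ 3 * dotp h h) / (2 * sg).
  by rewrite /sg; field; rewrite !gt_eqF.
move: split lo; rewrite /penalized /ng; set W := dotp (_ - _ - _) _ / _.
set W' := dotp (_ - _) _ / _.
lra.
Qed.

End PointSteps.

(** * Impossibility of a positive interior maximum of the doubled functional *)

Section Contradiction.
Context {R : realType} {n : nat}.
Variables (Omega D : set 'rV[R]_n) (g : 'rV[R]_n -> R).
Hypothesis Omega_open : open Omega.
Hypothesis OmegaD : Omega `<=` D.
Hypothesis D_compact : compact D.
Hypothesis g_cont : continuous g.
Hypothesis g_gt0 : forall x, Omega x -> 0 < g x.
Hypothesis g_eq0 : forall x, D x -> ~ Omega x -> g x = 0.
Hypothesis g_sub : quadratic_subsolution Omega 1 g.
Hypothesis g_super : quadratic_subsolution Omega (-1) (fun x => - g x).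
Variables (t1 t2 : R) (c : 'rV[R]_n).
Hypotheses (t10 : 0 < t1) (t20 : 0 <= t2).

Definition opp_fun (f : 'rV[R]_n -> R) : 'rV[R]_n -> R := fun x => - f x.

(* Sup-convolutions of [g] at [x] and [y] against the inf-convolution of [g] at
   [t1 x + t2 y + c], before taking the extrema over [x'], [y'], [z']. *)
Definition doubling (s : R) (x y x' y' z' : 'rV[R]_n) : R :=
  t1 * root4 (penalized g x s x') ^+ 3 + t2 * root4 (penalized g y s y') ^+ 3
  - root4 (- penalized (opp_fun g) (t1 *: x + t2 *: y + c) s z') ^+ 3.

(** Maximality bounds the terms at [x] and [y] by the one at [z], so all three share the gradient
    [P]. Displacing them along their flows then leads to [second_order_contradiction]. When [t2 = 0]
    maximality says nothing about [y], which is therefore taken equal to [x]. *)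
Lemma no_doubling_max s x0 y0 x1 y1 z1 :
  let z0 := t1 *: x0 + t2 *: y0 + c in
  0 < s -> Omega x0 -> Omega y0 -> Omega z0 -> D x1 -> D y1 -> D z1 ->
  (t2 = 0 -> y0 = x0 /\ y1 = x1) ->
  (forall y, D y -> penalized g x0 s y <= penalized g x0 s x1) ->
  (forall y, D y -> penalized g y0 s y <= penalized g y0 s y1) ->
  (forall y, D y -> penalized (opp_fun g) z0 s y <= penalized (opp_fun g) z0 s z1) ->
  (forall t y1, 0 < t <= s -> D y1 -> (forall y, D y ->
    penalized (opp_fun g) z0 t y <= penalized (opp_fun g) z0 t y1) -> Omega y1) ->
  (forall x y x' y' z', D x -> D y -> D x' -> D y' -> D z' ->
    doubling s x y x' y' z' <= doubling s x0 y0 x1 y1 z1) ->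
  0 < doubling s x0 y0 x1 y1 z1 -> False.
Proof.
move=> z0; have z0E : z0 = t1 *: x0 + t2 *: y0 + c := erefl.
clearbody z0 => s0 Ox0 Oy0 Oz0 Dx1 Dy1 Dz1 deg x1M y1M z1M int MC gap.
have sn0 : s != 0 by rewrite gt_eqF.
have Dx0 := OmegaD Ox0; have Dy0 := OmegaD Oy0; have Dz0 := OmegaD Oz0.
rewrite /doubling -z0E in MC gap.
have Oz1 : Omega z1 by apply: (int s) => //; rewrite s0 lexx.
set a := root4 (penalized g x0 s x1) in MC gap.
set b := root4 (penalized g y0 s y1) in MC gap.
have [Z ZE] : {Z | Z = - penalized (opp_fun g) z0 s z1} by eexists; reflexivity.
rewrite -ZE in MC gap.
have Z0 : 0 < Z.
  rewrite ZE /penalized /opp_fun opprD !opprK.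
  by rewrite ltr_pwDl ?g_gt0// divr_ge0 ?dotp_ge0// mulr_ge0// ltW.
set d := root4 Z in MC gap.
have d0 : 0 < d by rewrite root4_gt0.
have d4 : d ^+ 4 = Z by apply: root4K; exact: ltW.
have gX x x' : Omega x -> (forall y, D y -> penalized g x s y <= penalized g x s x') ->
    0 < penalized g x s x'.
  move=> Ox xM; apply: lt_le_trans (xM _ (OmegaD Ox)).
  by rewrite penalized_center; exact: g_gt0.
have a0 : 0 < a by rewrite root4_gt0; exact: gX x1M.
have b0 : 0 < b by rewrite root4_gt0; exact: gX y1M.
pose P := d^-1 *: (s^-1 *: (z0 - z1)).
have zetaE : s^-1 *: (z0 - z1) = d *: P by rewrite /P scalerA divff ?scale1r// gt_eqF.
clearbody P.
set N := dotp P P.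
(* With [z1] frozen, the inf-convolution term is a power [3/4] of a quadratic polynomial in [q];
   [cube_le_tangent] bounds it by its tangent with slope [3/4 P] and an explicit quadratic error. *)
have upZ q : root4 (- penalized (opp_fun g) (z0 + q) s z1) ^+ 3 <=
    d ^+ 3 + 3 / 4 * dotp P q + 3 / (8 * s * d) * dotp q q.
  rewrite penalized_shift//.
  have -> : s^-1 *: (z1 - z0) = - (d *: P) by rewrite -zetaE -scalerN opprB.
  rewrite dotpNl dotpZl.
  have -> : - (penalized (opp_fun g) z0 s z1 + - (d * dotp P q) - dotp q q / (2 * s)) =
     Z + d * dotp P q + dotp q q / (2 * s) by rewrite ZE; ring.
  set W := Z + _ + _.
  have W0 : 0 <= W.
    rewrite /W ZE.
    have -> : - penalized (opp_fun g) z0 s z1 + d * dotp P q + dotp q q / (2 * s) =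
        - penalized (opp_fun g) (z0 + q) s z1.
      rewrite penalized_shift//.
      have -> : s^-1 *: (z1 - z0) = - (d *: P) by rewrite -zetaE -scalerN opprB.
      by rewrite dotpNl dotpZl; ring.
    rewrite /penalized /opp_fun opprD !opprK addr_ge0 ?(ltW (g_gt0 Oz1))//.
    by rewrite divr_ge0 ?dotp_ge0// mulr_ge0// ltW.
  apply: le_trans (cube_le_tangent (root4_ge0 W) d0) _.
  rewrite root4K// d4 /W le_eqVlt; apply/orP; left; apply/eqP; field.
  by rewrite gt_eqF.
have C0 t : 0 <= t -> 0 <= 3 / (8 * s * d) * t.
  by move=> ?; rewrite mulr_ge0// divr_ge0// !mulr_ge0// ltW.
have Fx q x' : D (x0 + q) -> D x' -> root4 (penalized g (x0 + q) s x') ^+ 3 <=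
    a ^+ 3 + 3 / 4 * dotp P q + 3 / (8 * s * d) * t1 * dotp q q.
  move=> Dq Dx'; have := MC _ _ _ _ _ Dq Dy0 Dx' Dy1 Dz1.
  have -> : t1 *: (x0 + q) + t2 *: y0 + c = z0 + t1 *: q.
    by rewrite z0E scalerDr [RHS]addrAC; congr (_ + _); exact: addrAC.
  have := upZ (t1 *: q); rewrite !(dotpZl, dotpZr) -/b => u1 u2.
  rewrite -(@ler_pM2l _ t1)//.
  set r := root4 _ ^+ 3 in u2 *; set r' := root4 _ ^+ 3 in u1 u2.
  clear -u1 u2; clearbody a b d r r'; lra.
(* The constant uses [t1 + t2] so that it also covers [t2 = 0], where the bound at [x0] is
   reused. *)
have Fy q x' : D (y0 + q) -> D x' -> root4 (penalized g (y0 + q) s x') ^+ 3 <=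
    b ^+ 3 + 3 / 4 * dotp P q + 3 / (8 * s * d) * (t1 + t2) * dotp q q.
  have [t2E|t2n0] := eqVneq t2 0.
    have [yx yx1] := deg t2E; rewrite /b yx yx1 t2E addr0; exact: Fx.
  have t2p : 0 < t2 by rewrite lt_neqAle eq_sym t2n0.
  move=> Dq Dx'; have := MC _ _ _ _ _ Dx0 Dq Dx1 Dx' Dz1.
  have -> : t1 *: x0 + t2 *: (y0 + q) + c = z0 + t2 *: q.
    by rewrite z0E scalerDr addrA [RHS]addrAC.
  have := upZ (t2 *: q); rewrite !(dotpZl, dotpZr) -/a => u1 u2.
  have u3 : 0 <= 3 / (8 * s * d) * t1 * dotp q q.
    by rewrite -mulrA C0// mulr_ge0 ?dotp_ge0// ltW.
  apply: (@le_trans _ _ (b ^+ 3 + 3 / 4 * dotp P q + 3 / (8 * s * d) * t2 * dotp q q)).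
    rewrite -(@ler_pM2l _ t2)//.
    set r := root4 _ ^+ 3 in u2 *; set r' := root4 _ ^+ 3 in u1 u2.
    clear -u1 u2; clearbody a b d r r'; lra.
  rewrite mulrDr mulrDl; move: u3; set u := _ * t1 * _; set v := _ * t2 * _.
  lra.
have [ex ex0 [Kx Kx0 Hx]] := @subsolution_step R n Omega D g Omega_open OmegaD
  D_compact g_cont g_gt0 g_eq0 x0 x1 s P _ g_sub Ox0 Dx1 s0 x1M
  (C0 _ (ltW t10)) Fx.
have [ey ey0 [Ky Ky0 Hy]] := @subsolution_step R n Omega D g Omega_open OmegaD
  D_compact g_cont g_gt0 g_eq0 y0 y1 s P _ g_sub Oy0 Dy1 s0 y1M
  (C0 _ (addr_ge0 (ltW t10) t20)) Fy.
rewrite -/a -/N in Hx; rewrite -/b -/N in Hy.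
have Hz := @supersolution_step R n Omega D g Omega_open OmegaD D_compact g_cont
  z0 z1 s P d g_super Dz0 Dz1 s0 z1M int.
rewrite -/(opp_fun g) -ZE -/N in Hz.
have {}Hz := Hz (esym d4) d0 zetaE.
pose W := t1 * a ^+ 3 + t2 * b ^+ 3.
have d30 : 0 < d ^+ 3 by rewrite exprn_gt0.
have Wd : d ^+ 3 < W by rewrite -subr_gt0.
have W0 : 0 < W by apply: lt_trans Wd.
pose k := W / d ^+ 3.
have k1 : 1 < k by rewrite ltr_pdivlMr// mul1r.
pose th1 := t1 * a ^+ 3 / W; pose th2 := t2 * b ^+ 3 / W.
have th10 : 0 <= th1.
  by rewrite divr_ge0 ?(ltW W0)// mulr_ge0 ?(ltW t10)// exprn_ge0// ltW.
have th20 : 0 <= th2.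
  by rewrite divr_ge0 ?(ltW W0)// mulr_ge0// exprn_ge0// ltW.
have thE : th1 + th2 = 1 by rewrite /th1 /th2 -mulrDl divff// gt_eqF.
have [e e0 He] := second_order_contradiction k1 (dotp_ge0 P) (addr_ge0 Kx0 Ky0)
  th10 th20 thE.
have kd0 : 0 < k * d ^+ 2 by rewrite mulr_gt0 ?exprn_gt0//; lra.
pose m := Num.min (Num.min ex ey) (Num.min e (s / (k * d ^+ 2))).
have m0 : 0 < m by rewrite !lt_min ex0 ey0 e0 divr_gt0.
pose tau := m / 2.
have tau0 : 0 < tau by rewrite divr_gt0.
have : tau < m by rewrite /tau; lra.
rewrite !lt_min => /andP[/andP[taux tauy] /andP[taue taus]].
have [hx [x2 [cx [Dhx Dx2 cx0 [rx lox expx]]]]] := Hx tau (introT andP (conj tau0 taux)).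
have [hy [y2 [cy [Dhy Dy2 cy0 [ry loy expy]]]]] := Hy tau (introT andP (conj tau0 tauy)).
have [z2 Dz2 upz] : exists2 z2, D z2 & forall h,
    - penalized (opp_fun g) (z0 + d ^+ 3 *: h) s z2 <= d ^+ 4 *
    (1 + k * tau * N / 2 - (k * tau) ^+ 2 / 2 + dotp h h / (2 * (k * tau))).
  apply: Hz; first by rewrite mulr_gt0//; lra.
  by move: taus; rewrite ltr_pdivlMr//; lra.
(* The displacements at [x] and [y] move the third point by [t1 a^3 hx + t2 b^3 hy], which is
   [d^3 k hm] by the choice of the weights [th1], [th2]. *)
pose hm := th1 *: hx + th2 *: hy.
have {}upz := upz (k *: hm).
have [val valE] : {v | v = - penalized (opp_fun g) (z0 + d ^+ 3 *: (k *: hm)) s z2}.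
  by eexists; reflexivity.
rewrite -valE in upz.
have val0 : 0 <= val.
  rewrite valE /penalized /opp_fun opprD !opprK addr_ge0//; last first.
    by rewrite divr_ge0 ?dotp_ge0// mulr_ge0// ltW.
  by have [/g_gt0/ltW//|/(g_eq0 Dz2)->] := pselect (Omega z2).
have zE : t1 *: (x0 + a ^+ 3 *: hx) + t2 *: (y0 + b ^+ 3 *: hy) + c =
    z0 + d ^+ 3 *: (k *: hm).
  have -> : d ^+ 3 *: (k *: hm) = (t1 * a ^+ 3) *: hx + (t2 * b ^+ 3) *: hy.
    rewrite /hm !scalerDr !scalerA; congr (_ *: _ + _ *: _).
      by rewrite /th1 /k; field; rewrite !gt_eqF.
    by rewrite /th2 /k; field; rewrite !gt_eqF.
  by rewrite !scalerDr !scalerA z0E addrACA [RHS]addrAC.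
have := MC _ _ _ _ _ Dhx Dhy Dx2 Dy2 Dz2; rewrite zE -valE rx ry => mc.
have rv4 : root4 val ^+ 4 = val by exact: root4K.
apply: (He tau cx cy (root4 val / d) (dotp hx hx) (dotp hy hy) (dotp hm hm)) => //.
- by rewrite tau0.
- by rewrite divr_ge0 ?root4_ge0// ltW.
- by apply: le_trans expx _; rewrite ler_pM2r ?exprn_gt0// lerDl.
- by apply: le_trans expy _; rewrite ler_pM2r ?exprn_gt0// lerDr.
- have := dotp_ge0 (hx - hy); rewrite dotp_sub_sqr => hxy.
  rewrite /hm !dotpE (dotpC hy hx).
  have := mulr_ge0 (mulr_ge0 th10 th20) hxy.
  have -> : th2 = 1 - th1 by rewrite -thE addrAC subrr add0r.
  set A := dotp hx hx; set B := dotp hy hy; set X := dotp hx hy.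
  clear; lra.
- rewrite expr_div_n rv4 ler_pdivrMr ?exprn_gt0//.
  apply: le_trans upz _; rewrite mulrC ler_pM2r ?exprn_gt0//.
  rewrite dotpZl dotpZr -/N le_eqVlt; apply/orP; left; apply/eqP.
  clearbody k tau; field.
  by rewrite !gt_eqF//; lra.
- rewrite expr_div_n.
  have -> : k * (th1 * (cx ^+ 3 - 1) + th2 * (cy ^+ 3 - 1)) =
     (t1 * (a * cx) ^+ 3 + t2 * (b * cy) ^+ 3 - (t1 * a ^+ 3 + t2 * b ^+ 3)) / d ^+ 3.
    by rewrite /k /th1 /th2; field; rewrite !gt_eqF.
  have -> : root4 val ^+ 3 / d ^+ 3 - 1 = (root4 val ^+ 3 - d ^+ 3) / d ^+ 3.
    by field; rewrite gt_eqF.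
  rewrite ler_pM2r ?invr_gt0//.
  by rewrite lerBlDl addrCA -lerBlDl.
Qed.

End Contradiction.

(** * The two-point inequality *)

Section TwoPoint.
Context {R : realType} {n : nat}.
Variables (Omega D : set 'rV[R]_n) (g : 'rV[R]_n -> R).
Hypothesis Omega_open : open Omega.
Hypothesis OmegaD : Omega `<=` D.
Hypothesis D_compact : compact D.
Hypothesis g_cont : continuous g.
Hypothesis g_gt0 : forall x, Omega x -> 0 < g x.
Hypothesis g_eq0 : forall x, D x -> ~ Omega x -> g x = 0.
Hypothesis g_sub : quadratic_subsolution Omega 1 g.
Hypothesis g_super : quadratic_subsolution Omega (-1) (fun x => - g x).

Lemma continuous_penalized (T : topologicalType) (f : 'rV[R]_n -> R)
    (x x' : T -> 'rV[R]_n) s : continuous f -> continuous x -> continuous x' ->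
  continuous (fun p => penalized f (x p) s (x' p)).
Proof.
move=> cf cx cx'; rewrite /penalized; apply: continuous_sub => [p|].
  by apply: (@continuous_comp _ _ _ x' f); [exact: cx'|exact: cf].
apply: continuous_mul; last exact: cst_continuous.
have cs : continuous (fun p => x' p - x p) by exact: continuous_sub.
exact: continuous_dotp.
Qed.

Lemma continuous_root4_cube (T : topologicalType) (f : T -> R) :
  continuous f -> continuous (fun p => root4 (f p) ^+ 3).
Proof.
move=> cf.
have cr : continuous (fun p => root4 (f p)).
  by move=> p; apply: (@continuous_comp _ _ _ f root4); [exact: cf|exact: continuous_root4].
have -> : (fun p => root4 (f p) ^+ 3) =
    (fun p => root4 (f p) * (root4 (f p) * root4 (f p))).
  by apply/funext => p; rewrite !exprS expr0 mulr1.
by apply: continuous_mul => //; exact: continuous_mul.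
Qed.

Lemma continuous_doubling t1 t2 c s : let V := 'rV[R]_n in
  continuous (fun p : ((V * V) * (V * V)) * V =>
    doubling g t1 t2 c s p.1.1.1 p.1.1.2 p.1.2.1 p.1.2.2 p.2).
Proof.
move=> V; pose T : topologicalType := (((V * V) * (V * V)) * V)%type.
have cf (A B C : topologicalType) (h : A -> B * C) : continuous h -> continuous (fun a => (h a).1).
  by move=> ch a; apply: (@continuous_comp _ _ _ h fst); [exact: ch|exact: cvg_fst].
have cs (A B C : topologicalType) (h : A -> B * C) : continuous h -> continuous (fun a => (h a).2).
  by move=> ch a; apply: (@continuous_comp _ _ _ h snd); [exact: ch|exact: cvg_snd].
have c0 : continuous (fun p : T => p.1) by move=> p; exact: cvg_fst.
have cx : continuous (fun p : T => p.1.1.1) by do 2 apply: (cf).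
have cy : continuous (fun p : T => p.1.1.2) by apply: cs; exact: cf.
have cx' : continuous (fun p : T => p.1.2.1) by apply: cf; exact: cs.
have cy' : continuous (fun p : T => p.1.2.2) by do 2 apply: (cs).
have cz' : continuous (fun p : T => p.2) by move=> p; exact: cvg_snd.
have copp : continuous (opp_fun g).
  by move=> x; apply: continuousN; exact: g_cont.
apply: continuous_sub.
  apply: continuous_add; apply: continuous_mul; try exact: cst_continuous.
    apply: (@continuous_root4_cube T (fun p : T => penalized g p.1.1.1 s p.1.2.1)).
    exact: (@continuous_penalized T _ _ _ s g_cont cx cx').
  apply: (@continuous_root4_cube T (fun p : T => penalized g p.1.1.2 s p.1.2.2)).
    exact: (@continuous_penalized T _ _ _ s g_cont cy cy').
have cz : continuous (fun p : T => t1 *: p.1.1.1 + t2 *: p.1.1.2 + c).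
  apply: continuous_add; last exact: cst_continuous.
  apply: continuous_add; first exact: (@continuous_scale R T _ t1 _ cx).
  exact: (@continuous_scale R T _ t2 _ cy).
apply: (@continuous_root4_cube T (fun p : T => - penalized (opp_fun g)
  (t1 *: p.1.1.1 + t2 *: p.1.1.2 + c) s p.2)).
have -> : (fun p : T => - penalized (opp_fun g)
  (t1 *: p.1.1.1 + t2 *: p.1.1.2 + c) s p.2) =
  (fun p : T => 0 - penalized (opp_fun g)
  (t1 *: p.1.1.1 + t2 *: p.1.1.2 + c) s p.2).
  by apply/funext => p; rewrite sub0r.
apply: continuous_sub; first exact: cst_continuous.
exact: (@continuous_penalized T _ _ _ s copp cz cz').
Qed.

(** A violation survives regularisation for a small [s], and the boundary hypothesis places the
    maximum of the doubled functional in the situation excluded by [no_doubling_max]. *)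
Lemma two_point_inequality (t1 t2 : R) (c : 'rV[R]_n) : 0 < t1 -> 0 <= t2 ->
  let w x := root4 (g x) ^+ 3 in
  (forall x y, D x -> D y -> D (t1 *: x + t2 *: y + c)) ->
  (forall x y, Omega x -> D y -> Omega (t1 *: x + t2 *: y + c)) ->
  (forall x y, D x -> D y -> g x = 0 \/ t2 <> 0 /\ g y = 0 ->
    t1 * w x + t2 * w y <= w (t1 *: x + t2 *: y + c)) ->
  forall x y, D x -> D y -> t1 * w x + t2 * w y <= w (t1 *: x + t2 *: y + c).
Proof.
move=> t10 t20 w mapD mapO bdry xs ys Dxs Dys; rewrite leNgt; apply/negP => gap.
pose z x y : 'rV[R]_n := t1 *: x + t2 *: y + c.
pose Phi x y := t1 * w x + t2 * w y - w (z x y).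
pose M0 := Phi xs ys.
have M00 : 0 < M0 by rewrite subr_gt0.
have g_ge0 x : D x -> 0 <= g x.
  by move=> Dx; have [/g_gt0/ltW//|/(g_eq0 Dx)->] := pselect (Omega x).
have g_pos x : D x -> 0 < g x -> Omega x.
  move=> Dx gx; apply: contrapT => /(g_eq0 Dx) g0.
  by rewrite g0 ltxx in gx.
have w_pos x : D x -> 0 < w x -> 0 < g x.
  move=> Dx wx; rewrite lt_neqAle g_ge0// andbT eq_sym; apply/eqP => g0.
  by move: wx; rewrite /w g0 root4_le0// expr0n ltxx.
have w_gt0 x : 0 < g x -> 0 < w x.
  by move=> gx; rewrite exprn_gt0// root4_gt0.
have w_ge0 x : 0 <= w x by rewrite exprn_ge0// root4_ge0.
have PhiO x y : D x -> D y -> 0 < Phi x y -> Omega x /\ (t2 <> 0 -> Omega y).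
  move=> Dx Dy P0; split.
    apply: contrapT => /(g_eq0 Dx) g0; have := bdry x y Dx Dy (or_introl g0).
    by apply/negP; rewrite -ltNge -subr_gt0.
  move=> t2n0; apply: contrapT => /(g_eq0 Dy) g0.
  have := bdry x y Dx Dy (or_intror (conj t2n0 g0)).
  by apply/negP; rewrite -ltNge -subr_gt0.
pose V := ('rV[R]_n * 'rV[R]_n)%type.
have c1 : continuous (fun p : V => p.1) by move=> p; exact: cvg_fst.
have c2 : continuous (fun p : V => p.2) by move=> p; exact: cvg_snd.
have cw : continuous w by exact: continuous_root4_cube.
have comp_w (T : topologicalType) (h : T -> 'rV[R]_n) :
    continuous h -> continuous (fun p => w (h p)).
  by move=> ch p; apply: (@continuous_comp _ _ _ h w); [exact: ch|exact: cw].
have cz : continuous (fun p : V => z p.1 p.2).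
  apply: continuous_add; last exact: cst_continuous.
  by apply: continuous_add; exact: continuous_scale.
have cPhi : continuous (fun p : V => Phi p.1 p.2).
  apply: continuous_sub; last exact: (comp_w _ _ cz).
  apply: continuous_add; apply: continuous_mul; try exact: cst_continuous.
    exact: (comp_w _ _ c1).
  exact: (comp_w _ _ c2).
(* The maximum of the regularised functional will lie in [K]. By compactness [w] at the third point
   has a positive lower bound [mz] there, so that point stays away from the boundary. *)
pose K := (D `*` D) `&` [set p : V | M0 / 2 <= Phi p.1 p.2].
have cK : compact K.
  by apply: compact_closedI; [exact: compact_setX|exact: closed_superlevel].
have K0 : K !=set0 by exists (xs, ys); split => //=; rewrite -/M0; lra.
have [[xm ym] [[/= Dxm Dym] /= Pm] mM] := compact_min K0 cK (comp_w _ _ cz).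
have Phim0 : 0 < Phi xm ym by apply: lt_le_trans Pm; lra.
have mz0 : 0 < w (z xm ym).
  by apply: w_gt0; apply: g_gt0; apply: mapO => //; exact: (PhiO _ _ Dxm Dym Phim0).1.
set mz := w _ in mz0 mM.
have T0 : 0 < t1 + t2 + 1 by lra.
(* The first bound limits the total regularisation error to [M0 / 2]; the second keeps [w] positive
   at points close to the third one. *)
pose eps := Num.min (M0 / (2 * (t1 + t2 + 1))) mz.
have eps0 : 0 < eps by rewrite lt_min mz0 divr_gt0// mulr_gt0.
have epsM : (t1 + t2 + 1) * eps <= M0 / 2.
  have : eps <= M0 / (2 * (t1 + t2 + 1)) by rewrite ge_min lexx.
  by rewrite ler_pdivlMr ?mulr_gt0//; lra.
have epsz : eps <= mz by rewrite ge_min lexx orbT.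
have [delta delta0 unif] := compact_uniform_continuity D_compact cw eps0.
have D0 : D !=set0 by exists xs.
have [xg Dxg gM] := compact_max D0 D_compact g_cont.
have Gm0 : 0 < g xg.
  have [Oxm _] := PhiO _ _ Dxm Dym Phim0.
  by apply: lt_le_trans (gM _ Dxm); exact: g_gt0.
(* A point with a competitive penalty has squared distance at most [2 s max g = delta / 2] from the
   centre, within reach of uniform continuity. *)
have [s s0 sE] : exists2 s, 0 < s & 2 * s * g xg = delta / 2.
  exists (delta / (4 * g xg)); first by rewrite divr_gt0// mulr_gt0.
  by field; rewrite gt_eqF.
have sup_le x x' : D x -> D x' -> root4 (penalized g x s x') ^+ 3 <= w x + eps.
  move=> Dx Dx'; have [X0|X0] := leP (penalized g x s x') 0.
    by rewrite root4_le0// expr0n addr_ge0// ltW.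
  have gx' : penalized g x s x' <= g x'.
    by rewrite gerBl divr_ge0 ?dotp_ge0// mulr_ge0// ltW.
  have close : dotp (x' - x) (x' - x) < delta.
    move: X0; rewrite /penalized subr_gt0 ltr_pdivrMr ?mulr_gt0//.
    have : g x' * (2 * s) <= g xg * (2 * s).
      by apply: ler_wpM2r; [rewrite mulr_ge0// ltW|exact: gM].
    lra.
  have : root4 (penalized g x s x') ^+ 3 <= w x'.
    by rewrite /w ler_pXn2r ?nnegrE ?root4_ge0// ler_root4.
  have := unif _ _ Dx' Dx close; rewrite ltr_norml => /andP[_]; lra.
have near_le t zz y : 0 < t <= s -> D zz -> D y ->
    - penalized (opp_fun g) zz t y <= g zz -> w zz - eps < w y.
  move=> /andP[t0 ts] Dz Dy; rewrite /penalized /opp_fun opprD !opprK => H.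
  have : dotp (y - zz) (y - zz) / (2 * t) <= g xg.
    by have := gM _ Dz; have := g_ge0 _ Dy; lra.
  rewrite ler_pdivrMr ?mulr_gt0// => le.
  have : g xg * (2 * t) <= g xg * (2 * s) by rewrite ler_pM2l//; lra.
  move=> le2; have := unif y zz Dy Dz; rewrite ltr_norml => U.
  have /U/andP[+ _] : dotp (y - zz) (y - zz) < delta by lra.
  lra.
have inf_ge zz y : D zz -> D y ->
    w zz - eps <= root4 (- penalized (opp_fun g) zz s y) ^+ 3.
  move=> Dz Dy; have [le|gt] := leP (- penalized (opp_fun g) zz s y) (g zz).
    have := near_le s zz y; rewrite s0 lexx => /(_ isT Dz Dy le).
    have : w y <= root4 (- penalized (opp_fun g) zz s y) ^+ 3.
      rewrite /w ler_pXn2r ?nnegrE ?root4_ge0// ler_root4//.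
      rewrite /penalized /opp_fun opprD !opprK lerDl.
      by rewrite divr_ge0 ?dotp_ge0// mulr_ge0// ltW.
    lra.
  apply: (@le_trans _ _ (w zz)); first by rewrite gerBl ltW.
  by rewrite /w ler_pXn2r ?nnegrE ?root4_ge0// ler_root4// ltW.
pose Theta x y x' y' z' := doubling g t1 t2 c s x y x' y' z'.
pose T := (((('rV[R]_n * 'rV[R]_n) * ('rV[R]_n * 'rV[R]_n)) * 'rV[R]_n)%type).
pose D5 : set T := ((D `*` D) `*` (D `*` D)) `*` D.
have D50 : D5 !=set0 by exists (((xs, ys), (xs, ys)), xs).
have cD5 : compact D5 by do ?apply: compact_setX.
have [[[[x0 y0'] [x1 y1']] z1] [[[/= Dx0 Dy0'] [/= Dx1 Dy1']] /= Dz1] MT] :=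
  compact_max D50 cD5 (@continuous_doubling t1 t2 c s).
have {}MT x y x' y' z' : D x -> D y -> D x' -> D y' -> D z' ->
    Theta x y x' y' z' <= Theta x0 y0' x1 y1' z1.
  by move=> *; apply: (MT (((x, y), (x', y')), z')).
have [y0 [y1 [Dy0 Dy1 deg thE]]] : exists y0 y1, [/\ D y0, D y1,
    t2 = 0 -> y0 = x0 /\ y1 = x1 &
    Theta x0 y0 x1 y1 z1 = Theta x0 y0' x1 y1' z1].
  have [t2E|/eqP t2n0] := eqVneq t2 0; last by exists y0', y1'.
  exists x0, x1; split; [exact: Dx0|exact: Dx1|by []|].
  by rewrite /Theta /doubling t2E !mul0r !scale0r.
rewrite -thE in MT => {thE y0' y1' Dy0' Dy1'}.
have Dz0 : D (z x0 y0) by exact: mapD.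
have Theta_le : Theta x0 y0 x1 y1 z1 <= Phi x0 y0 + M0 / 2.
  have A1 : t1 * root4 (penalized g x0 s x1) ^+ 3 <= t1 * (w x0 + eps).
    by rewrite ler_pM2l// sup_le.
  have A2 : t2 * root4 (penalized g y0 s y1) ^+ 3 <= t2 * (w y0 + eps).
    by rewrite ler_wpM2l// sup_le.
  have := inf_ge _ _ Dz0 Dz1.
  rewrite /Theta /doubling /Phi -/(z x0 y0); move: A1 A2 epsM; lra.
have center f x : penalized f x s x = f x by exact: penalized_center.
have Theta_ge : M0 <= Theta x0 y0 x1 y1 z1.
  apply: le_trans (MT xs ys xs ys (z xs ys) Dxs Dys Dxs Dys (mapD _ _ Dxs Dys)).
  by rewrite /Theta /doubling -/(z xs ys) !center /opp_fun opprK.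
have Phi0 : M0 / 2 <= Phi x0 y0 by lra.
have Phi00 : 0 < Phi x0 y0 by lra.
have [Ox0 Oy0'] := PhiO _ _ Dx0 Dy0 Phi00.
have Oy0 : Omega y0.
  by have [/deg[->]//|/eqP/Oy0'] := eqVneq t2 0.
have Oz0 : Omega (z x0 y0) by exact: mapO.
have wz0 : mz <= w (z x0 y0) by apply: (mM (x0, y0)); split.
(* [root4] does not distinguish nonpositive values, so maximality passes to the penalized values
   only once the maximal one is known to be positive, by comparison with the centre. *)
have maxE f x x1' y1'' : root4 (penalized f x s y1'') ^+ 3 <= root4 (penalized f x s x1') ^+ 3 ->
    0 < penalized f x s x1' -> penalized f x s y1'' <= penalized f x s x1'.
  move=> le x1p; have [p|p] := leP (penalized f x s y1'') 0.
    exact: le_trans p (ltW x1p).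
  exact: root4_cube_inj le p.
have x1M y : D y -> penalized g x0 s y <= penalized g x0 s x1.
  have cmp y' : D y' -> root4 (penalized g x0 s y') ^+ 3 <= root4 (penalized g x0 s x1) ^+ 3.
    move=> Dy'; have := MT x0 y0 y' y1 z1 Dx0 Dy0 Dy' Dy1 Dz1.
    rewrite /Theta /doubling !lerD2r; by rewrite ler_pM2l.
  move=> Dy; apply: maxE; first exact: cmp.
  apply: lt_le_trans (g_gt0 Ox0) _; apply: root4_cube_inj (g_gt0 Ox0).
  by have := cmp _ Dx0; rewrite center.
have y1M y : D y -> penalized g y0 s y <= penalized g y0 s y1.
  have [/deg[-> ->]|/eqP t2n0] := eqVneq t2 0; first exact: x1M.
  have t2p : 0 < t2 by rewrite lt_neqAle t20 andbT eq_sym; apply/eqP.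
  have cmp y' : D y' -> root4 (penalized g y0 s y') ^+ 3 <= root4 (penalized g y0 s y1) ^+ 3.
    move=> Dy'; have := MT x0 y0 x1 y' z1 Dx0 Dy0 Dx1 Dy' Dz1.
    rewrite /Theta /doubling lerD2r lerD2l; by rewrite ler_pM2l.
  move=> Dy; apply: maxE; first exact: cmp.
  apply: lt_le_trans (g_gt0 Oy0) _; apply: root4_cube_inj (g_gt0 Oy0).
  by have := cmp _ Dy0; rewrite center.
have opp_ge0 y : D y -> 0 <= - penalized (opp_fun g) (z x0 y0) s y.
  move=> Dy; rewrite /penalized /opp_fun opprD !opprK addr_ge0 ?g_ge0//.
  by rewrite divr_ge0 ?dotp_ge0// mulr_ge0// ltW.
have z1M y : D y -> penalized (opp_fun g) (z x0 y0) s y <=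
    penalized (opp_fun g) (z x0 y0) s z1.
  move=> Dy; rewrite -lerN2.
  have [p|p] := leP (- penalized (opp_fun g) (z x0 y0) s z1) 0.
    by apply: le_trans p _; exact: opp_ge0.
  apply: root4_cube_inj p.
  have := MT x0 y0 x1 y1 y Dx0 Dy0 Dx1 Dy1 Dy.
  by rewrite /Theta /doubling lerD2l lerN2.
apply: (@no_doubling_max R n Omega D g Omega_open OmegaD D_compact g_cont g_gt0
  g_eq0 g_sub g_super t1 t2 c t10 t20 s x0 y0 x1 y1 z1) => //.
(* By [near_le], [w y] exceeds [w (z x0 y0) - eps >= mz - eps >= 0], so [y] lies in [Omega]. *)
- move=> t y /andP[t0 ts] Dy yM; apply: (g_pos _ Dy); apply: (w_pos _ Dy).
  have := near_le t (z x0 y0) y; rewrite t0 ts => /(_ isT Dz0 Dy).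
  have := yM _ Dz0; rewrite penalized_center /opp_fun lerNl => le /(_ le).
  lra.
- exact: lt_le_trans M00 Theta_ge.
Qed.

End TwoPoint.

(** * Reduction of the theorem to the two-point inequality *)

Section ConvexSets.
Context {R : realType} {n : nat}.
Implicit Types (x y z : 'rV[R]_n) (A : set 'rV[R]_n).
Local Open Scope convex_scope.

Lemma conv_lmodE (x y : convex_lmodType 'rV[R]_n) (t : {i01 R}) :
  x <| t |> y = t%:num *: (x : 'rV[R]_n) + (1 - t%:num) *: (y : 'rV[R]_n).
Proof. by []. Qed.

Lemma conv_realE (a b : R^o) (t : {i01 R}) :
  a <| t |> b = t%:num * (a : R) + (1 - t%:num) * (b : R).
Proof. by []. Qed.

Lemma convex_setE A x y (t : R) : convex_set A -> 0 <= t <= 1 ->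
  A x -> A y -> A (t *: x + (1 - t) *: y).
Proof.
move=> cA /andP[t0 t1] Ax Ay.
by have := cA x y (Itv01 t0 t1) (mem_set Ax) (mem_set Ay) => /set_mem.
Qed.

Lemma closureP A x : closure A x <->
  forall e, 0 < e -> exists2 y, A y & dotp (y - x) (y - x) < e.
Proof.
split=> [cx e e0|H B /nbhs_dotpP[e e0 eB]].
  have [|y [Ay ye]] := cx [set y | dotp (y - x) (y - x) < e].
    by apply/nbhs_dotpP; exists e.
  by exists y.
by have [y Ay /eB] := H e e0; exists y.
Qed.

Lemma closure_convex_setE A x y (t : R) : convex_set A -> 0 <= t <= 1 ->
  closure A x -> closure A y -> closure A (t *: x + (1 - t) *: y).
Proof.
move=> cA t01 /closureP cx /closureP cy; apply/closureP => e e0.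
have [x' Ax' xe] := cx e e0; have [y' Ay' ye] := cy e e0.
exists (t *: x' + (1 - t) *: y'); first exact: convex_setE.
have -> : t *: x' + (1 - t) *: y' - (t *: x + (1 - t) *: y) =
    t *: (x' - x) + (1 - t) *: (y' - y).
  by rewrite opprD addrACA -!scalerBr.
apply: le_lt_trans (dotp_convex _ _ t01) _.
case/andP: t01; rewrite le_eqVlt => /predU1P[<- _|t0 t1].
  by rewrite mul0r add0r subr0 mul1r.
have : t * dotp (x' - x) (x' - x) < t * e by rewrite ltr_pM2l.
have : (1 - t) * dotp (y' - y) (y' - y) <= (1 - t) * e.
  by rewrite ler_wpM2l ?subr_ge0// ltW.
lra.
Qed.

(** Replace [y] by a nearby [y'] in [A] and compensate by moving [x] by [- r (y' - y)] with
    [r = (1 - t) / t]; for [y'] close enough the moved point is still in [A]. *)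
Lemma open_convex_closure A x y (t : R) : convex_set A -> open A -> 0 < t <= 1 ->
  A x -> closure A y -> A (t *: x + (1 - t) *: y).
Proof.
move=> cA oA /andP[t0 t1] Ax /closureP cy.
have [e e0 eA] : exists2 e : R, 0 < e & forall y, dotp (y - x) (y - x) < e -> A y.
  by apply/nbhs_dotpP; exact: open_nbhs_nbhs.
pose r := (1 - t) / t.
have r0 : 0 <= r by rewrite divr_ge0 ?subr_ge0// ltW.
have r21 : 0 < r ^+ 2 + 1 by rewrite ltr_wpDl// sqr_ge0.
have [|y' Ay' ye] := cy (e / (r ^+ 2 + 1)); first by rewrite divr_gt0.
have -> : t *: x + (1 - t) *: y = t *: (x - r *: (y' - y)) + (1 - t) *: y'.
  have -> : t *: (x - r *: (y' - y)) = t *: x - (1 - t) *: (y' - y).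
    by rewrite scalerBr scalerA /r mulrC divfK// gt_eqF.
  by rewrite scalerBr opprB addrA subrK.
apply: convex_setE => //; first by rewrite (ltW t0).
apply: eA; rewrite addrC addKr dotpNl dotpNr opprK dotpZl dotpZr.
move: ye; rewrite ltr_pdivlMr//.
have := dotp_ge0 (y' - y); lra.
Qed.

End ConvexSets.

(** * The Dirichlet solution extended by zero: continuity, equation and positivity *)

Section Dirichlet.
Context {R : realType} {n : nat}.
Variables (Omega : set 'rV[R]_n) (u : 'rV[R]_n -> R).
Hypothesis Omega_open : open Omega.
Hypothesis u_sol : dirichlet_solution Omega u.

(** The values of [u] off the closure are arbitrary, whereas the sup-convolution lemmas ask for a
    function continuous on the whole space. *)
Definition zero_extension : 'rV[R]_n -> R :=
  fun x => if pselect (Omega x) then u x else 0.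

Local Notation g := zero_extension.

Lemma zero_extension_in x : Omega x -> g x = u x.
Proof. by rewrite /g; case: pselect. Qed.

Lemma zero_extension_out x : ~ Omega x -> g x = 0.
Proof. by rewrite /g; case: pselect. Qed.

Lemma continuous_zero_extension : continuous g.
Proof.
have [cu bu _] := u_sol.
have key x : closure Omega x -> g x = u x.
  move=> cx; have [Ox|nOx] := pselect (Omega x); first exact: zero_extension_in.
  rewrite zero_extension_out// bu//; split=> //.
  by move: Omega_open => /interior_id ->.
suff near_g x e : 0 < e -> \forall y \near x, `|g x - g y| < e.
  move=> x; apply/(@cvgrPdist_lt _ _ _ (nbhs x) _ g (g x)) => e e0; exact: near_g.
move=> e0; have [cx|ncx] := pselect (closure Omega x); last first.
  have oC : open (~` closure Omega) by apply: closed_openC; exact: closed_closure.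
  apply: filterS (open_nbhs_nbhs (conj oC ncx)) => y ncy.
  have -> : g x = 0 by apply: zero_extension_out => /subset_closure; exact: ncx.
  have -> : g y = 0 by apply: zero_extension_out => /subset_closure; exact: ncy.
  by rewrite subrr normr0.
have ux : u @ within (closure Omega) (nbhs x) --> u x.
  by move/subspace_continuousP : cu; apply.
have ex : \forall y \near x, closure Omega y -> `|u x - u y| < e.
  by move/cvgrPdist_lt : ux => /(_ e e0).
have [Ox|nOx] := pselect (Omega x).
  have On : \forall y \near x, Omega y by exact: open_nbhs_nbhs.
  apply: filterS2 ex On => y yu Oy; rewrite !zero_extension_in//.
  by apply: yu; exact: subset_closure.
apply: filterS ex => y yu.
have [Oy|nOy] := pselect (Omega y); last by rewrite !zero_extension_out// subrr normr0.
have cy : closure Omega y by exact: subset_closure.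
by rewrite (key _ cx) key// yu.
Qed.

Lemma zero_extension_quadratic_subsolution :
  quadratic_subsolution Omega 1 g /\
  quadratic_subsolution Omega (-1) (fun x => - g x).
Proof.
have [_ _ /viscosity_quadratic_subsolution[sub super]] := u_sol.
split=> x G k L Ox tx.
- apply: (sub x) => //.
  have On : \forall y \near x, Omega y by exact: open_nbhs_nbhs.
  by apply: filterS2 tx On => y + Oy; rewrite !zero_extension_in.
- apply: (super x) => //.
  have On : \forall y \near x, Omega y by exact: open_nbhs_nbhs.
  by apply: filterS2 tx On => y + Oy; rewrite !zero_extension_in.
Qed.

(** At an interior minimum a constant is a test function with operator value [0], which the
    supersolution inequality forbids. If [g x <= 0], the minimum over the closure would be interior,
    or equal to [0] on the boundary and then also attained at [x]. *)
Lemma zero_extension_gt0 x : compact (closure Omega) -> Omega x -> 0 < g x.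
Proof.
move=> cD Ox; rewrite ltNge; apply/negP => gx0.
have no_min y : Omega y -> ~ forall z, closure Omega z -> g y <= g z.
  move=> Oy ym.
  have [_ super] := zero_extension_quadratic_subsolution.
  have := super y 0 0 0 Oy; rewrite !mul0r addr0 oppr0 => H.
  suff : 0 <= -1 :> R by lra.
  apply: H; have On : \forall y0 \near y, Omega y0 by exact: open_nbhs_nbhs.
  apply: filterS On => z Oz.
  rewrite /quadratic_test (dotpC 0) dotp0 !mul0r !addr0 lerN2.
  exact/ym/subset_closure.
have cx : closure Omega x by exact: subset_closure.
have [m cm mM] := compact_min (ex_intro _ _ cx) cD continuous_zero_extension.
have [Om|nOm] := pselect (Omega m); first exact: no_min Om mM.
apply: (no_min x Ox) => z cz; apply: le_trans gx0 _.
by rewrite -(zero_extension_out nOm) mM.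
Qed.

End Dirichlet.

(** * Compactness of the closure and concavity of the power [3/4] *)

Lemma bounded_closure_compact (R : realType) n (A : set 'rV[R]_n) :
  bounded_set A -> compact (closure A).
Proof.
move=> /ex_strict_bound_gt0[k k0 Ak].
pose B := [set x : 'rV[R]_n | `|x| <= k].
have cB : closed B.
  have cn : continuous (fun x : 'rV[R]_n => `|x|) by exact: norm_continuous.
  by move/continuous_closedP : cn => /(_ [set y | y <= k]); apply; exact: closed_le.
have bB : bounded_set B.
  exists k; split=> [|M kM x /= xk]; first exact: num_real.
  exact: le_trans xk (ltW kM).
apply: (@subclosed_compact _ (closure A) B).
- exact: closed_closure.
- exact: bounded_closed_compact.
- by rewrite closureE; apply: smallest_sub => // y Ay; apply/ltW/Ak.
Qed.

Theorem theorem1 (R : realType) (n : nat) (Omega : set 'rV[R]_n)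
    (u : 'rV[R]_n -> R)
    (Omega_neq0 : Omega !=set0)
    (Omega_open : open Omega)
    (Omega_bounded : bounded_set Omega)
    (Omega_convex : convex_set Omega)
    (Omega_sphere : interior_sphere_condition Omega)
    (u_sol : dirichlet_solution Omega u) :
  concave_function Omega (fun x => u x `^ (3 / 4)).
Proof.
pose D := closure Omega.
have cD : compact D by exact: bounded_closure_compact.
have OD : Omega `<=` D by exact: subset_closure.
pose g := zero_extension Omega u.
have cg : continuous g := continuous_zero_extension Omega_open u_sol.
have [gsub gsup] := zero_extension_quadratic_subsolution Omega_open u_sol.
have g0 x : Omega x -> 0 < g x by exact: zero_extension_gt0.
have gout x : D x -> ~ Omega x -> g x = 0 by move=> _; exact: zero_extension_out.
pose w x := root4 (g x) ^+ 3.
have w0 x : g x = 0 -> w x = 0 by rewrite /w => ->; rewrite root4_le0// expr0n.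
have w_ge0 x : 0 <= w x by rewrite exprn_ge0// root4_ge0.
have two := @two_point_inequality R n Omega D g Omega_open OD cD cg g0 gout gsub gsup.
(* The two-point inequality with [t2 = 0] and [c = (1 - t) y]: at a zero of [g] the left side
   vanishes, so the boundary hypothesis is immediate. *)
have bdr x y (t : R) : 0 < t <= 1 -> D x -> D y -> t * w x <= w (t *: x + (1 - t) *: y).
  move=> /[dup] t01 /andP[t0 t1] Dx Dy.
  have := two t 0 ((1 - t) *: y) t0 (lexx _) _ _ _ x x Dx Dx.
  rewrite scale0r addr0 mul0r addr0; apply.
  - move=> x' y' Dx' _; rewrite scale0r addr0.
    by apply: closure_convex_setE => //; rewrite (ltW t0).
  - move=> x' y' Ox' _; rewrite scale0r addr0; exact: open_convex_closure.
  - move=> x' y' Dx' _; rewrite scale0r addr0 mul0r addr0.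
    by move=> [gx|[]//]; rewrite -/(w x') w0// mulr0 w_ge0.
have main x y (t : R) : 0 < t < 1 -> Omega x -> Omega y ->
    t * w x + (1 - t) * w y <= w (t *: x + (1 - t) *: y).
  move=> /andP[t0 t1] Ox Oy; have t'0 : 0 < 1 - t by rewrite subr_gt0.
  have := two t (1 - t) 0 t0 (ltW t'0) _ _ _ x y (OD _ Ox) (OD _ Oy).
  rewrite addr0; apply.
  - move=> x' y' Dx' Dy'; rewrite addr0.
    by apply: closure_convex_setE => //; rewrite !ltW.
  - move=> x' y' Ox' Dy'; rewrite addr0.
    by apply: open_convex_closure => //; rewrite t0 ltW.
  (* When one of the two values vanishes the claim is [bdr], with the roles of the points exchanged
     if the zero is at [x']. *)
  - move=> x' y' Dx' Dy'; rewrite addr0 -!/(w _) => -[gx|[_ gy]].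
      rewrite (w0 x')// mulr0 add0r.
      have -> : t *: x' + (1 - t) *: y' = (1 - t) *: y' + (1 - (1 - t)) *: x'.
        by rewrite subKr addrC.
      by apply: bdr => //; rewrite t'0 gerBl ltW.
    by rewrite (w0 y')// mulr0 addr0; apply: bdr => //; rewrite t0 ltW.
move=> t x y /set_mem Ox /set_mem Oy.
have uw z : Omega z -> u z `^ (3 / 4) = w z.
  move=> Oz; have := g0 z Oz; rewrite /w /g zero_extension_in// => uz.
  by rewrite powR_three_quarters// ltW.
have Oz : Omega (t%:num *: x + (1 - t%:num) *: y).
  by apply: convex_setE => //; rewrite ge0 le1.
rewrite conv_lmodE conv_realE !uw//.
have : 0 <= t%:num by [].
rewrite le_eqVlt => /predU1P[<-|t0].
  by rewrite subr0 mul0r add0r scale0r add0r mul1r scale1r.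
have : t%:num <= 1 by rewrite le1.
rewrite le_eqVlt => /predU1P[->|t1].
  by rewrite subrr mul0r addr0 scale0r addr0 mul1r scale1r.
by apply: main => //; rewrite t0.
Qed.
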